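(* For every integer $n\ge0$, the set $$\{\mathrm{pr}\,K\,\Delta_\lambda\,K(1)\;:\;\lambda \text{ a partition of } n \text{ all of whose parts are }\ge 3\}$$ is a vector space basis of $\mathcal{H}_n$.
   Context: Partitions are non-increasing sequences of non-negative integers, eventually $0$. Let $\mathcal{S}$ be the set of non-increasing, eventually constant integer sequences. For $\lambda\in\mathcal{S}$ with eventual value $n$, define $Q_k(\lambda)$ ($k\ge0$) by $\sum_{k\ge0}Q_k(\lambda)z^{k-1}=e^{nz}\big(\frac{1}{e^{z/2}-e^{-z/2}}+\sum_{i\ge1}(e^{z(\lambda_i-n-i+1/2)}-e^{z(-i+1/2)})\big)$ (Laurent expansion at $z=0$); $Q_0=1$, $Q_1(\lambda)=n$, $Q_2(\lambda)=|\lambda|-\tfrac1{24}$ on partitions. Let $\Lambda^*=\mathbb{Q}[Q_2,Q_3,\ldots]$ and $\mathcal{R}=\mathbb{Q}[Q_1,Q_2,\ldots]$ (polynomial rings; $Q_i$ has weight $i$; subscript $n$ = weight-$n$ part). Let $\tilde{\mathcal{R}}=\mathcal{R}[Q_2^{-1/2}]$ and $\tilde\Lambda=\Lambda^*[Q_2^{-1/2}]$, graded likewise ($Q_2^{s}$ has weight $2s$). Let $\mathrm{pr}:\tilde{\mathcal{R}}\to\tilde\Lambda$ be the algebra homomorphism sending $Q_1\mapsto0$ and fixing $Q_i$, $i\ge2$. With $Q_0:=1$, differential operators act on $\tilde{\mathcal{R}}$ in the variables $Q_1,Q_2,\ldots$ (with $\frac{\partial}{\partial Q_2}Q_2^{s}=sQ_2^{s-1}$).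 Let $\boldsymbol{\partial}=\sum_{m\ge0}Q_m\frac{\partial}{\partial Q_{m+1}}$, $\mathscr{D}=\sum_{k,\ell\ge0}\binom{k+\ell}{k}Q_{k+\ell}\frac{\partial^2}{\partial Q_{k+1}\partial Q_{\ell+1}}$, $\Delta=\tfrac12(\mathscr{D}-\boldsymbol{\partial}^2)$, and $\mathcal{H}_n=\{f\in\Lambda^*_n:\Delta f\in Q_1\mathcal{R}\}$. For $\vec i=(i_1,\ldots,i_m)\in\mathbb{Z}_{\ge0}^m$ put $|\vec i|=i_1+\cdots+i_m$ and $\partial_{\vec i}=\frac{\partial^m}{\partial Q_{i_1+1}\cdots\partial Q_{i_m+1}}$; define $\mathscr{D}_m=\sum_{\vec i\in\mathbb{Z}_{\ge0}^m}\binom{|\vec i|}{i_1,\ldots,i_m}Q_{|\vec i|}\partial_{\vec i}$ (multinomial coefficient; $\mathscr{D}_0=1$), $\Delta_m=\sum_{i=0}^m(-1)^i\binom{m}{i}\mathscr{D}_{m-i}\boldsymbol{\partial}^i$, and for a partition $\lambda=(\lambda_1,\ldots,\lambda_\ell)$, $\Delta_\lambda=\binom{|\lambda|}{\lambda_1,\ldots,\lambda_\ell}\prod_{i}\Delta_{\lambda_i}$ (the $\mathscr{D}_m$ pairwise commute). The partition-Kelvin transform $K$ sends a weight-$m$ homogeneous element $f$ of $\tilde{\mathcal{R}}$ to $K(f)=Q_2^{3/2-m}f$ (weight $3-m$); in particular $K(1)=Q_2^{3/2}$. *)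

(* Defs.v *)
From HB Require Import structures.
From mathcomp Require Import all_boot all_order all_algebra.
From mathcomp Require Import finmap.
From mathcomp.multinomials Require Import monalg.

Set Implicit Arguments.
Unset Strict Implicit.
Unset Printing Implicit Defensive.

Import Order.TTheory GRing.Theory Num.Theory.
Local Open Scope ring_scope.

Section LinearExtension.
Variables (K : choiceType) (V : lmodType rat).
Implicit Types (F : K -> V) (f g : {malg rat[K]}).

Definition linext F f : V := \sum_(k <- msupp f) f@_k *: F k.

Lemma linextEw F f (d : {fset K}) : (msupp f `<=` d)%fset ->
  linext F f = \sum_(k <- d) f@_k *: F k.
Proof.
move=> le; rewrite /linext (big_fset_incl _ le) // => k _ /mcoeff_outdom ->.
by rewrite scale0r.
Qed.

Lemma linextU F c k : linext F << c *g k >> = c *: F k.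
Proof. by rewrite (linextEw _ msuppU_le) big_seq_fset1 mcoeffUU. Qed.

Fact linext_is_linear F : linear (linext F).
Proof.
move=> c f g; set d := (msupp (c *: f + g) `|` (msupp f `|` msupp g))%fset.
have [fd gd] : (msupp f `<=` d)%fset /\ (msupp g `<=` d)%fset.
  by split; apply: fsubset_trans (fsubsetUr _ _); rewrite (fsubsetUl, fsubsetUr).
rewrite (linextEw F fd) (linextEw F gd) (@linextEw F _ d) ?fsubsetUl //.
rewrite scaler_sumr -big_split /=; apply: eq_bigr => k _.
by rewrite mcoeffD mcoeffZ scalerDl scalerA.
Qed.

HB.instance Definition _ F :=
  GRing.isLinear.Build rat {malg rat[K]} V *:%R (linext F) (linext_is_linear F).

Lemma eq_linear_malg (h1 h2 : {linear {malg rat[K]} -> V}) :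
  (forall k, h1 << 1 *g k >> = h2 << 1 *g k >>) -> h1 =1 h2.
Proof.
move=> eqh f; rewrite (monalgE f) !linear_sum; apply: eq_bigr => k _.
have -> : << f@_k *g k >> = f@_k *: << 1 *g k >> :> {malg rat[K]}.
  by apply/malgP => k'; rewrite mcoeffZ !mcoeffU -mulr_natr -[1 *+ _]mulr_natr mul1r.
by rewrite !linearZ /= eqh.
Qed.
End LinearExtension.

(* Exponent vectors, with [e@_i] the exponent of Q_i.  Arbitrary rational
   exponents are allowed here; the rings R~ = R[Q_2^(-1/2)], R and Lambda^* are
   cut out below by restricting the exponents. *)
Definition expo := {malg rat[nat]}.
HB.instance Definition _ := GRing.Lmodule.on expo.

Definition delta (i : nat) : expo := << 1 *g i >>.

(* The group algebra of [expo] over rat; multinomials only puts a ring structure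
   on [{malg R[M]}] for monoids M without nontrivial units. *)
Definition qalg := {malg rat[expo]}.
HB.instance Definition _ := GRing.Lmodule.on qalg.

Definition mono (e : expo) : qalg := << 1 *g e >>.

HB.lock Definition qmul (f g : qalg) : qalg :=
  linext (fun e => linext (fun e' => mono (e + e')) g) f.

Lemma linext_lin_r (K : choiceType) (V W : lmodType rat) (F : K -> {linear V -> W})
    (f : {malg rat[K]}) :
  linear (fun v => linext (fun k => F k v) f).
Proof.
move=> c u v; rewrite /linext scaler_sumr -big_split /=; apply: eq_bigr => k _.
by rewrite linearP scalerDr !scalerA mulrC.
Qed.

Lemma qmul_mono e e' : qmul (mono e) (mono e') = mono (e + e').
Proof. by rewrite unlock !linextU !scale1r. Qed.

Fact qmul_linear_l g : linear (qmul^~ g).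
Proof. by move=> c f f'; rewrite unlock linearP. Qed.

Fact qmul_linear_r f : linear (qmul f).
Proof. by rewrite unlock; apply: linext_lin_r. Qed.

Lemma qalgE (f : qalg) : f = \sum_(e <- msupp f) f@_e *: mono e.
Proof.
rewrite {1}(monalgE f); apply: eq_bigr => e _; apply/malgP => e'.
by rewrite mcoeffZ !mcoeffU -mulr_natr -[1 *+ _]mulr_natr mul1r.
Qed.

Lemma qalg_ind (P : qalg -> Prop) :
  (forall e, P (mono e)) -> (forall c f g, P f -> P g -> P (c *: f + g)) ->
  forall f, P f.
Proof.
move=> Pm Plin f.
have P0 : P 0 by rewrite -(subrr (mono 0)) addrC -scaleN1r; apply: Plin.
by rewrite (qalgE f); apply: (big_rec P) => // e g _ Pg; apply: Plin.
Qed.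

Fact qmulC : commutative qmul.
Proof.
move=> f g; elim/qalg_ind: f => [e|c f f' IH IH'].
  elim/qalg_ind: g => [e'|c g g' IH IH']; first by rewrite !qmul_mono addrC.
  by rewrite qmul_linear_r qmul_linear_l IH IH'.
by rewrite qmul_linear_r qmul_linear_l IH IH'.
Qed.

Fact qmulA : associative qmul.
Proof.
move=> f g h; elim/qalg_ind: f => [e|c f f' IH IH']; last first.
  by rewrite !qmul_linear_l IH IH'.
elim/qalg_ind: g => [e'|c g g' IH IH']; last first.
  by rewrite qmul_linear_l !qmul_linear_r qmul_linear_l IH IH'.
elim/qalg_ind: h => [e''|c h h' IH IH']; last first.
  by rewrite !qmul_linear_r IH IH'.
by rewrite !qmul_mono addrA.
Qed.

Fact qmul1 : left_id (mono 0) qmul.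
Proof.
elim/qalg_ind => [e|c g g' IH IH']; first by rewrite qmul_mono add0r.
by rewrite qmul_linear_r IH IH'.
Qed.

Fact qmulDl : left_distributive qmul +%R.
Proof. by move=> f g h; rewrite -[f]scale1r qmul_linear_l !scale1r. Qed.

Fact qone_neq0 : mono 0 != 0.
Proof. by rewrite monalgU_eq0 oner_eq0. Qed.

HB.instance Definition _ :=
  GRing.Zmodule_isComNzRing.Build qalg qmulA qmulC qmul1 qmulDl qone_neq0.

Fact qscaleAl (c : rat) (f g : qalg) : c *: (f * g) = (c *: f) * g.
Proof.
have := qmul_linear_l g c f 0; rewrite addr0 -[qmul 0 g]/(0 * g) mul0r addr0.
by move/esym.
Qed.

HB.instance Definition _ := GRing.Lmodule_isLalgebra.Build rat qalg qscaleAl.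
HB.instance Definition _ := GRing.Lalgebra_isComAlgebra.Build rat qalg.

Lemma monoM e e' : mono e * mono e' = mono (e + e').
Proof. exact: qmul_mono. Qed.

Definition qvar (m : nat) : qalg := if m is 0 then 1 else mono (delta m).

Definition pder (i : nat) : qalg -> qalg :=
  linext (fun e => e@_i *: mono (e - delta i)).

HB.instance Definition _ i := GRing.Linear.on (pder i).

Lemma pder_mono i e : pder i (mono e) = e@_i *: mono (e - delta i).
Proof. by rewrite /pder linextU scale1r. Qed.

Lemma pderM i f g : pder i (f * g) = pder i f * g + f * pder i g.
Proof.
elim/qalg_ind: f => [e|c f f' IH IH']; last first.
  rewrite mulrDl -scalerAl !linearP /= IH IH' !mulrDl -!scalerAl scalerDr.
  by rewrite addrACA.
elim/qalg_ind: g => [e'|c g g' IH IH']; last first.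
  rewrite mulrDr -scalerAr !linearP /= IH IH' !mulrDr -!scalerAr scalerDr.
  by rewrite addrACA.
rewrite monoM !pder_mono mcoeffD -scalerAl -scalerAr !monoM.
by rewrite (addrA e e') (addrAC e e' (- _)) scalerDl.
Qed.

Lemma pder_qvar i m : pder i.+1 (qvar m) = (m == i.+1)%:R.
Proof.
case: m => [|m]; rewrite /= pder_mono; first by rewrite mcoeff0 scale0r.
by rewrite mcoeffU; case: eqP => [->|_]; rewrite ?scale0r // subrr scale1r.
Qed.

(* The largest index of a variable occurring in f.  Thus the infinite sums over
   k >= 0 with a factor d/dQ_(k+1) below reduce to sums over k < nvars f;
   see [pder_nvars] and [bpartialE], [calDE], [scrDE]. *)
Definition nvars (f : qalg) : nat :=
  \max_(e <- msupp f) \max_(i <- msupp e) i.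

Lemma pder_nvars f i : (nvars f < i)%N -> pder i f = 0.
Proof.
move=> lti; rewrite /pder /linext big1_seq // => e /andP[_ ef].
rewrite (@mcoeff_outdom _ _ e i) ?scale0r ?scaler0 //; apply: contraL lti => ie.
rewrite -leqNgt; have le_ie : (i <= \max_(j <- msupp e) j)%N.
  by rewrite (big_rem i) //= leq_maxl.
by rewrite /nvars (big_rem e) //= leq_max le_ie.
Qed.

Definition bpartial (f : qalg) : qalg :=
  \sum_(m < nvars f) qvar m * pder m.+1 f.

Definition calD (f : qalg) : qalg :=
  \sum_(k < nvars f) \sum_(l < nvars f)
    'C(k + l, k)%:R *: (qvar (k + l) * pder k.+1 (pder l.+1 f)).

Lemma sum_nvars f N (F : nat -> qalg) :
    (nvars f <= N)%N -> (forall i, pder i.+1 f = 0 -> F i = 0) ->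
  \sum_(i < nvars f) F i = \sum_(i < N) F i.
Proof.
move=> leN F0; rewrite -!(big_mkord xpredT F) (big_cat_nat (leq0n _) leN) /=.
rewrite [X in _ = _ + X]big_nat_cond [X in _ = _ + X]big1 ?addr0 // => i.
by rewrite andbT => /andP[lei _]; rewrite F0 // pder_nvars.
Qed.

Lemma bpartialE f N : (nvars f <= N)%N ->
  bpartial f = \sum_(m < N) qvar m * pder m.+1 f.
Proof.
move=> leN; apply: (sum_nvars (F := fun m => qvar m * pder m.+1 f)) => // i ->.
by rewrite mulr0.
Qed.

Lemma pderC i j f : pder i (pder j f) = pder j (pder i f).
Proof.
elim/qalg_ind: f => [e|c f f' IH IH']; last by rewrite !linearP /= IH IH'.
rewrite !pder_mono !linearZ /= !pder_mono !scalerA !mcoeffB !mcoeffU.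
rewrite (addrAC e (- delta j)) eq_sym; case: eqP => [->|_] //=.
by rewrite !subr0 mulrC.
Qed.

Lemma calDE f N : (nvars f <= N)%N ->
  calD f = \sum_(k < N) \sum_(l < N)
    'C(k + l, k)%:R *: (qvar (k + l) * pder k.+1 (pder l.+1 f)).
Proof.
move=> leN; transitivity (\sum_(k < nvars f) \sum_(l < N)
    'C(k + l, k)%:R *: (qvar (k + l) * pder k.+1 (pder l.+1 f))).
  apply: eq_bigr => k _; apply: (sum_nvars (F := fun l =>
    'C(k + l, k)%:R *: (qvar (k + l) * pder k.+1 (pder l.+1 f)))) => // l ->.
  by rewrite linear0 mulr0 scaler0.
apply: (sum_nvars (F := fun k => \sum_(l < N)
    'C(k + l, k)%:R *: (qvar (k + l) * pder k.+1 (pder l.+1 f)))) => // k fk.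
by rewrite big1 // => l _; rewrite pderC fk linear0 mulr0 scaler0.
Qed.

Definition Delta (f : qalg) : qalg := 2^-1 *: (calD f - bpartial (bpartial f)).

Definition multinomial (s : seq nat) : rat :=
  (sumn s)`!%:R / \prod_(i <- s) i`!%:R.

Definition pders (s : seq nat) (f : qalg) : qalg :=
  foldr (fun i => pder i.+1) f s.

Definition scrD (m : nat) (f : qalg) : qalg :=
  \sum_(t : m.-tuple 'I_(nvars f)) let s := map val t in
    multinomial s *: (qvar (sumn s) * pders s f).

Lemma pder_pders i s f : pder i (pders s f) = pders s (pder i f).
Proof. by elim: s => [//|j s IH] /=; rewrite pderC IH. Qed.

Lemma pders0 s : pders s 0 = 0.
Proof. by elim: s => [//|j s IH] /=; rewrite IH linear0. Qed.

Lemma pders_eq0 s f i : i \in s -> pder i.+1 f = 0 -> pders s f = 0.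
Proof.
move=> + fi; elim: s => [//|j s IH]; rewrite in_cons /= => /orP[/eqP<-|/IH->].
  by rewrite pder_pders fi pders0.
by rewrite linear0.
Qed.

Lemma scrDE m f N : (nvars f <= N)%N ->
  scrD m f = \sum_(t : m.-tuple 'I_N) let s := map val t in
    multinomial s *: (qvar (sumn s) * pders s f).
Proof.
move=> leN; pose w (i : 'I_(nvars f)) := widen_ord leN i.
pose F (s : seq nat) := multinomial s *: (qvar (sumn s) * pders s f).
rewrite [RHS](bigID (fun t : m.-tuple 'I_N => all (fun i : 'I_N => i < nvars f)%N t)).
rewrite /= [X in _ + X]big1 ?addr0; last first.
  move=> t /allPn[i ti]; rewrite -leqNgt => lei.
  have fi : pder (val i).+1 f = 0 by rewrite pder_nvars.
  by rewrite (pders_eq0 (map_f val ti) fi) mulr0 scaler0.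
have w_inj : injective (fun t : m.-tuple 'I_(nvars f) => [tuple of map w t]).
  move=> t1 t2 /(congr1 (map val \o val)) /=; rewrite -!map_comp => eq12.
  exact/val_inj/(inj_map val_inj).
transitivity (\sum_(t in [set [tuple of map w t] | t : m.-tuple 'I_(nvars f)])
    F (map val (val t))).
  rewrite big_imset /=; last by move=> t1 t2 _ _ /w_inj.
  apply: eq_big => [t|t _]; first by rewrite inE.
  by rewrite /F -map_comp.
apply: eq_bigl => t; apply/imsetP/allP => [[t' _ ->]|lt_t].
  by move=> i /mapP[j _ ->]; apply: (valP j).
have [s' Es'] : exists s' : seq 'I_(nvars f), map w s' = t.
  elim: (val t) lt_t => [|i s IH] lt_s; first by exists [::].
  have lti : (i < nvars f)%N by rewrite lt_s ?mem_head.
  have [|s' <-] := IH; first by move=> j js; rewrite lt_s ?inE ?js ?orbT.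
  by exists (Ordinal lti :: s'); congr cons; apply: val_inj.
have sz : size s' == m by rewrite -(size_map w) Es' size_tuple.
by exists (Tuple sz) => //; apply: val_inj.
Qed.

Definition Delta_ (m : nat) (f : qalg) : qalg :=
  \sum_(i < m.+1)
    ((-1) ^+ i * 'C(m, i)%:R) *: scrD (m - i) (iter i bpartial f).

Definition Delta_part (la : seq nat) (f : qalg) : qalg :=
  multinomial la *: foldr Delta_ f la.

Definition weight (e : expo) : rat := \sum_(i <- msupp e) i%:R * e@_i.

Definition homog (w : rat) : {pred qalg} :=
  fun f => all (fun e => weight e == w) (msupp f).

(* Linear extension of f |-> Q_2^(3/2 - w) f, f homogeneous of weight w;
   see [KelvinE]. *)
Definition Kelvin : qalg -> qalg :=
  linext (fun e => mono (e + (3 / 2 - weight e) *: delta 2)).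

(* On R~ this is the algebra morphism with Q_1 |-> 0 fixing the other Q_i,
   see [prM] and [pr_qvar]. *)
Definition pr : qalg -> qalg :=
  linext (fun e => if e@_1 == 0 then mono e else 0).

Definition calR_expo : {pred expo} :=
  fun e => all (fun i => (0 < i)%N && (e@_i \is a Num.nat)) (msupp e).

Definition Lambda_expo : {pred expo} :=
  fun e => all (fun i => (1 < i)%N && (e@_i \is a Num.nat)) (msupp e).

Definition tR_expo : {pred expo} :=
  fun e => all (fun i => (0 < i)%N &&
    (if i == 2 then e@_i *+ 2 \is a Num.int else e@_i \is a Num.nat)) (msupp e).

Definition calR : {pred qalg} := fun f => all calR_expo (msupp f).
Definition Lambda : {pred qalg} := fun f => all Lambda_expo (msupp f).
Definition tR : {pred qalg} := fun f => all tR_expo (msupp f).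

Definition harmonic (n : nat) (f : qalg) : Prop :=
  [/\ f \in Lambda, f \in homog n%:R
    & exists2 g, g \in calR & Delta f = qvar 1 * g].

Definition is_partition_of (n : nat) (la : seq nat) : bool :=
  [&& sorted geq la, all (leq 1) la & sumn la == n].

Section Basis.
Context (F : fieldType) (V : lmodType F).
Implicit Types X W : V -> Prop.

Definition lin_indep X : Prop :=
  forall (s : seq V) (c : V -> F), uniq s -> {in s, forall v, X v} ->
  \sum_(v <- s) c v *: v = 0 -> {in s, forall v, c v = 0}.

Definition in_span X (u : V) : Prop :=
  exists (s : seq V) (c : V -> F),
    {in s, forall v, X v} /\ u = \sum_(v <- s) c v *: v.

Definition is_basis X W : Prop :=
  lin_indep X /\ forall u, W u <-> in_span X u.
End Basis.

Lemma Lambda_calR : {subset Lambda <= calR}.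
Proof.
move=> f /allP fL; apply/allP => e /fL /allP eL; apply/allP => i /eL.
by move=> /andP[/ltnW-> ->].
Qed.

Lemma calR_tR : {subset calR <= tR}.
Proof.
move=> f /allP fL; apply/allP => e /fL /allP eL; apply/allP => i /eL.
by move=> /andP[-> ei]; case: ifP; rewrite // rpredMn // Num.Theory.intr_nat.
Qed.

Lemma KelvinE w f : f \in homog w ->
  Kelvin f = mono ((3 / 2 - w) *: delta 2) * f.
Proof.
move=> /allP fw; rewrite /Kelvin /linext [in RHS](qalgE f) mulr_sumr.
rewrite !big_seq; apply: eq_bigr => e /fw /eqP->.
by rewrite -scalerAr monoM (addrC e).
Qed.

Lemma pr_mono e : pr (mono e) = if e@_1 == 0 then mono e else 0.
Proof. by rewrite /pr linextU scale1r. Qed.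

Lemma pr_qvar m : pr (qvar m) = if m == 1%N then 0 else qvar m.
Proof.
case: m => [|m] /=; rewrite pr_mono; first by rewrite mcoeff0.
by rewrite mcoeffU eqSS pnatr_eq0; case: m.
Qed.

Lemma tR_expo_ge0 e i : e \in tR_expo -> i != 2 -> 0 <= e@_i.
Proof.
move=> /allP eR /negPf i2; have [ie|/mcoeff_outdom->//] := boolP (i \in msupp e).
by have /andP[_] := eR i ie; rewrite i2 => /natr_ge0.
Qed.

Lemma prM_mono e e' : e \in tR_expo -> e' \in tR_expo ->
  pr (mono e * mono e') = pr (mono e) * pr (mono e').
Proof.
move=> eR e'R; rewrite monoM !pr_mono mcoeffD.
rewrite paddr_eq0 ?(tR_expo_ge0 eR) ?(tR_expo_ge0 e'R) //.
by case: eqP; case: eqP; rewrite /= ?monoM ?mul0r ?mulr0.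
Qed.

HB.instance Definition _ := GRing.Linear.on pr.

Lemma prM : {in tR &, {morph pr : f g / f * g}}.
Proof.
have expand f : f \in tR -> exists (s : seq expo) (c : expo -> rat),
    {in s, forall e, e \in tR_expo} /\ f = \sum_(e <- s) c e *: mono e.
  move=> /allP fR; exists (msupp f), (fun e => f@_e); split => //.
  exact: qalgE.
move=> f g /expand[s [c [sR ->]]] /expand[s' [c' [s'R ->]]].
rewrite mulr_suml !linear_sum mulr_suml !(big_seq _ _ s).
apply: eq_bigr => e /sR eR; rewrite mulr_sumr linear_sum mulr_sumr.
rewrite !(big_seq _ _ s'); apply: eq_bigr => e' /s'R e'R.
by rewrite -scalerAl -scalerAr !linearZ /= prM_mono // -scalerAl -scalerAr.
Qed.

Lemma tR_expoP e : reflect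
  [/\ e@_0 = 0, e@_2 *+ 2 \is a Num.int &
      forall i, (i != 0)%N -> (i != 2)%N -> e@_i \is a Num.nat]
  (e \in tR_expo).
Proof.
apply: (iffP allP) => [eR|[e0 e2 en] i ie].
  split=> [||i i0 /negPf i2].
  - by have [/eR|/mcoeff_outdom//] := boolP (0%N \in msupp e).
  - have [/eR|/mcoeff_outdom->] := boolP (2%N \in msupp e); first by case/andP.
    by rewrite mul0rn rpred0.
  have [/eR|/mcoeff_outdom->] := boolP (i \in msupp e); last by rewrite rpred0.
  by rewrite i2 => /andP[].
have i0 : i != 0%N by apply: contraL ie => /eqP->; rewrite -mcoeff_eq0 e0.
by rewrite lt0n i0 /=; case: eqVneq => [->|i2] //; apply: en.
Qed.

Lemma tR_expoD e e' : e \in tR_expo -> e' \in tR_expo -> e + e' \in tR_expo.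
Proof.
move=> /tR_expoP[e0 e2 en] /tR_expoP[e'0 e'2 e'n]; apply/tR_expoP; split.
- by rewrite mcoeffD e0 e'0 addr0.
- by rewrite mcoeffD mulrnDl rpredD.
by move=> i i0 i2; rewrite mcoeffD rpredD ?en ?e'n.
Qed.

Lemma tR_linear c f g : f \in tR -> g \in tR -> c *: f + g \in tR.
Proof.
move=> /allP fR /allP gR; apply/allP => e /(fsubsetP (msuppD_le _ _)).
by rewrite in_fsetU => /orP[/(fsubsetP (msuppZ_le _ _))/fR|/gR].
Qed.

Lemma tR_mono e : (mono e \in tR) = (e \in tR_expo).
Proof.
rewrite [LHS]unfold_in msuppU oner_eq0.
apply/allP/idP => [eR|eR e' /fset1P-> //].
by apply: eR; rewrite fset11.
Qed.

Lemma tR_linext (F : expo -> qalg) f :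
  (forall e, e \in tR_expo -> F e \in tR) -> f \in tR -> linext F f \in tR.
Proof.
move=> FR /allP fR; rewrite /linext big_seq.
apply: (big_rec (fun g => g \in tR)); first by rewrite unfold_in msupp0.
by move=> e g /fR eR gR; apply: tR_linear => //; apply: FR.
Qed.

Lemma tRZ c f : f \in tR -> c *: f \in tR.
Proof.
by move=> fR; rewrite -[c *: f]addr0 tR_linear //= unfold_in msupp0.
Qed.

Lemma tRM f g : f \in tR -> g \in tR -> f * g \in tR.
Proof.
move=> fR gR; rewrite -[f * g]/(qmul f g) unlock.
apply: tR_linext => // e eR; apply: tR_linext => // e' e'R.
by rewrite tR_mono tR_expoD.
Qed.

Lemma tR_pder i f : f \in tR -> pder i f \in tR.
Proof.
apply: tR_linext => e eR /=; have [->|ei] := eqVneq e@_i 0.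
  by rewrite scale0r unfold_in msupp0.
rewrite tRZ // tR_mono; case/tR_expoP: eR => e0 e2 en; apply/tR_expoP; split.
- rewrite mcoeffB mcoeffU e0; case: (eqVneq i 0%N) ei => [->|_ _].
    by rewrite e0 eqxx.
  by rewrite subr0.
- by rewrite mcoeffB mcoeffU mulrnBl rpredB // !rpredMn.
move=> j j0 j2; rewrite mcoeffB mcoeffU; case: (eqVneq i j) ei => [->|_ _]; last first.
  by rewrite subr0 en.
case/natrP: (en j j0 j2) => [[|k] ->] // _.
by rewrite -natr1 addrK natr_nat.
Qed.

Lemma weight_int e : e \in tR_expo -> weight e \is a Num.int.
Proof.
move=> /tR_expoP[e0 e2 en]; rewrite /weight rpred_sum // => i _.
case: (eqVneq i 2) => [->|i2]; first by rewrite mulr_natl.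
case: (eqVneq i 0%N) => [->|i0]; first by rewrite mul0r rpred0.
by rewrite rpredM // intr_nat // en.
Qed.

Lemma tR_Kelvin f : f \in tR -> Kelvin f \in tR.
Proof.
apply: tR_linext => e eR; rewrite tR_mono tR_expoD //; apply/tR_expoP.
have wi := weight_int eR; split=> [||i i0 i2].
- by rewrite mcoeffZ mcoeffU mulr0.
- by rewrite mcoeffZ mcoeffU mulr1 mulrnBl rpredB // rpredMn.
by rewrite mcoeffZ mcoeffU eq_sym (negPf i2) mulr0 rpred0.
Qed.

(* Main.v *)
From HB Require Import structures.
Require Import Defs.
From mathcomp Require Import all_boot all_order all_algebra.
From mathcomp Require Import finmap.
From mathcomp.multinomials Require Import monalg.
From mathcomp Require Import ring lra zify.

(* With a(t) = sum_i t^i/i! d/dQ_(i+1) and the contraction L : t^k |-> k! Q_k one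
   has scrD_m = L o a(t)^m.  Since a(t) (k! Q_k) = (t^k)', commutators differentiate
   symbols in t, and the operators Delta_m are seen to commute with Delta and with
   multiplication by Q_1.  A direct computation gives, for f of weight w,
     Delta (Q_2^r f) = Q_2^r Delta f + r (w + r - 3/2) Q_2^(r-1) f  mod Q_1.
   For r = 3/2 - w the middle term vanishes, so that K preserves harmonicity modulo
   Q_1 and every pr K Delta_la K(1) is harmonic.  For an integer r > 0 that term
   does not vanish, so no nonzero harmonic element is divisible by Q_2.  Finally
   pr K Delta_la K(1) is a nonzero multiple of Q_la modulo Q_2, hence a harmonic
   element is determined by, and expanded along, its monomials free of Q_2. *)

Set Implicit Arguments.
Unset Strict Implicit.
Unset Printing Implicit Defensive.

Import Order.TTheory GRing.Theory Num.Theory.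
Local Open Scope ring_scope.

(** The operator scrD_m has order m, so its commutators are hard to handle directly; on symbols,
    polynomials in t over the ring, it becomes the m-th power of the derivation a(t). Neither a(t)^m
    nor L commutes with bpartial or calD. For bpartial, moving it past a(t)^m costs (a(t)^m f)', and
    moving it past L costs L of the same derivative; for calD both costs are 2m a' a^m f. They agree
    because f is constant in t, and so the composite L o a(t)^m commutes with both. Multiplication
    by Q_1 does not commute with scrD_m, since a(t) Q_1 = 1. The alternating binomial sum defining
    Delta_m is what cancels the defect; hence reduction modulo Q_1 is compatible with Delta, which
    is half of Delta_2. The constant 3/2 arises from Q_2^r: calD contributes 2r(r-1), bpartial^2
    contributes r, and the difference is 2r(r-3/2). Every nonvanishing needed later holds because an
    integer never equals 3/2. *)

(** * Symbols of the operators *)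

(* [d i] stands for d/dQ_(i+1) and [q m] for Q_m. *)
Section SymbolCalculus.
Variables (A : comAlgType rat) (d : nat -> {linear A -> A}) (q : nat -> A).
Hypothesis dM : forall i f g, d i (f * g) = d i f * g + f * d i g.
Hypothesis dC : forall i j f, d i (d j f) = d j (d i f).
Hypothesis dq : forall i m, d i (q m) = (m == i.+1)%:R.
Implicit Types (f g : A) (P Q : {poly A}) (i j k l m n N : nat).

Definition ifact i : A := (i`!%:R^-1 : rat)%:A.

Lemma ifactS i : i.+1%:R * ifact i.+1 = ifact i.
Proof.
rewrite /ifact mulr_natl -scaler_nat scalerA factS natrM invfM mulrA divff ?mul1r //.
by rewrite pnatr_eq0.
Qed.

Lemma factK i : i`!%:R * ifact i = 1.
Proof.
rewrite /ifact mulr_natl -scaler_nat scalerA divff ?scale1r //.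
by rewrite pnatr_eq0 -lt0n fact_gt0.
Qed.

Lemma der1 i : d i 1 = 0.
Proof. by apply: (addrI (d i 1)); rewrite addr0 -{3}(mul1r 1) dM mulr1 mul1r. Qed.

Lemma der_nat i n : d i n%:R = 0.
Proof. by rewrite raddfMn /= der1 mul0rn. Qed.

Lemma der_ifact i j : d i (ifact j) = 0.
Proof. by rewrite linearZ /= der1 scaler0. Qed.

Definition pder_poly i : {poly A} -> {poly A} := map_poly (d i).
Notation pd := pder_poly.
HB.instance Definition _ i := GRing.Additive.on (pd i).

Lemma coef_pd i P k : (pd i P)`_k = d i P`_k.
Proof. by rewrite coef_map. Qed.

Lemma pdM i P Q : pd i (P * Q) = pd i P * Q + P * pd i Q.
Proof.
apply/polyP => k; rewrite coefD coef_pd !coefM linear_sum -big_split /=.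
by apply: eq_bigr => j _; rewrite dM !coef_pd.
Qed.

Lemma pd_polyC i c : pd i c%:P = (d i c)%:P.
Proof. by rewrite /pd map_polyC. Qed.

Lemma pdXn i k : pd i 'X^k = 0.
Proof. by apply/polyP => j; rewrite coef_pd coefXn coef0 der_nat. Qed.

Lemma pdC i j P : pd i (pd j P) = pd j (pd i P).
Proof. by apply/polyP => k; rewrite !coef_pd dC. Qed.

Lemma pd_deriv i P : pd i P^`() = (pd i P)^`().
Proof. by apply/polyP => k; rewrite !(coef_pd, coef_deriv) raddfMn. Qed.

Definition dop (u : nat -> {poly A}) N P := \sum_(i < N) u i * pd i P.

Fact dop_additive u N : zmod_morphism (dop u N).
Proof.
move=> P Q; rewrite /dop -sumrB; apply: eq_bigr => i _.
by rewrite raddfB mulrBr.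
Qed.
HB.instance Definition _ u N :=
  GRing.isZmodMorphism.Build _ _ (dop u N) (dop_additive u N).

Lemma dopM u N P Q : dop u N (P * Q) = dop u N P * Q + P * dop u N Q.
Proof.
rewrite /dop mulr_suml mulr_sumr -big_split /=; apply: eq_bigr => i _.
rewrite pdM; ring.
Qed.

Lemma dop_dop u v N P :
  dop u N (dop v N P) = \sum_(i < N) \sum_(j < N)
    (u i * pd i (v j) * pd j P + u i * v j * pd i (pd j P)).
Proof.
apply: eq_bigr => i _; rewrite raddf_sum mulr_sumr; apply: eq_bigr => j _ /=.
by rewrite pdM mulrDr !mulrA.
Qed.

(** * The derivation a(t) on symbols and its commutators *)

Definition acoef i : {poly A} := (ifact i)%:P * 'X^i.
Definition qcoef i : {poly A} := (q i)%:P.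
Notation aop := (dop acoef).
Notation adop := (dop (fun i => (acoef i)^`())).
Notation bop := (dop qcoef).

Lemma pd_acoef i j : pd i (acoef j) = 0.
Proof. by rewrite pdM pd_polyC der_ifact pdXn mulr0 polyC0 mul0r addr0. Qed.

Lemma pd_acoef' i j : pd i (acoef j)^`() = 0.
Proof. by rewrite pd_deriv pd_acoef deriv0. Qed.

Lemma acoef0' : (acoef 0)^`() = 0.
Proof. by rewrite deriv_mulC expr0 derivC mulr0. Qed.

Lemma acoefS' i : (acoef i.+1)^`() = acoef i.
Proof.
rewrite deriv_mulC derivXn /= mulrnAr -mulrnAl -mulr_natl -polyC_natr -polyCM.
by rewrite ifactS.
Qed.

Lemma adop_aop N P : adop N (aop N P) = aop N (adop N P).
Proof.
rewrite !dop_dop exchange_big /=; apply: eq_bigr => i _; apply: eq_bigr => j _.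
by rewrite !(pd_acoef, pd_acoef') !mulr0 !mul0r !add0r mulrC pdC; ring.
Qed.

Lemma deriv_aop N P : (aop N P)^`() = adop N P + aop N P^`().
Proof.
rewrite /dop raddf_sum -big_split; apply: eq_bigr => i _ /=.
by rewrite derivM pd_deriv.
Qed.

(** The usual power rule: [f%:P] is constant in t, and the derivations a and a' commute because
    their coefficients involve only t and rational constants. *)
Lemma deriv_iter_aop m N f :
  (iter m.+1 (aop N) f%:P)^`() = adop N (iter m (aop N) f%:P) *+ m.+1.
Proof.
elim: m => [|m IH].
  by rewrite deriv_aop derivC raddf0 addr0 mulr1n.
by rewrite iterS deriv_aop IH raddfMn /= -adop_aop [RHS]mulrS.
Qed.

Lemma aop_deriv_iter m N f :
  aop N (iter m (aop N) f%:P)^`() = adop N (iter m (aop N) f%:P) *+ m.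
Proof.
case: m => [|m]; first by rewrite /= derivC raddf0.
by rewrite deriv_iter_aop raddfMn /= -adop_aop.
Qed.

(* Since [d i (q m)] is [1] exactly when [m = i.+1], the commutator of the two
   derivations shifts the index, which differentiates the symbol. *)
Lemma aop_bop N P : aop N (bop N P) = bop N (aop N P) + adop N P.
Proof.
rewrite !dop_dop [LHS]exchange_big /=.
transitivity (\sum_(j < N) \sum_(i < N) (qcoef j * acoef i * pd j (pd i P))
  + \sum_(j < N) \sum_(i < N) (acoef i * (j == i.+1 :> nat)%:R * pd j P)).
  rewrite -big_split; apply: eq_bigr => j _; rewrite -big_split; apply: eq_bigr => i _ /=.
  by rewrite pd_polyC dq polyC_natr pdC; ring.
congr (_ + _).
  by apply: eq_bigr => j _; apply: eq_bigr => i _; rewrite pd_acoef; ring.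
apply: eq_bigr => j _; rewrite -mulr_suml; congr (_ * _).
case: (j : nat) (ltn_ord j) => [|k] ltk.
  by rewrite acoef0' big1 // => i _; rewrite mulr0.
rewrite acoefS' (bigD1 (Ordinal (ltnW ltk))) //= eqxx mulr1 big1 ?addr0 // => i ik.
by rewrite eqSS (_ : _ == _ = false) ?mulr0 //; apply: contraNF ik => /eqP ki; apply/eqP/val_inj.
Qed.

(** In the induction, the new commutator a' and the image under a of the derivative already present
    add up to the derivative of the next power. *)
Lemma iter_aop_bop m N f :
  iter m (aop N) (bop N f%:P)
  = bop N (iter m (aop N) f%:P) + (iter m (aop N) f%:P)^`().
Proof.
elim: m => [|m IH]; first by rewrite /= derivC addr0.
by rewrite iterS IH raddfD /= aop_bop deriv_aop addrA.
Qed.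

(* The contraction [L] of the header. *)
Definition lfun P : A := \sum_(k < size P) P`_k * (k`!%:R * q k).

Lemma lfunE N P : (size P <= N)%N ->
  lfun P = \sum_(k < N) P`_k * (k`!%:R * q k).
Proof.
move=> leN; rewrite /lfun -!(big_mkord xpredT (fun k => P`_k * (k`!%:R * q k))).
rewrite (big_cat_nat (leq0n _) leN) /=.
rewrite [X in _ = _ + X]big_nat_cond [X in _ = _ + X]big1 ?addr0 // => i.
by rewrite andbT => /andP[lei _]; rewrite nth_default // mul0r.
Qed.

Fact lfun_additive : zmod_morphism lfun.
Proof.
move=> P Q; pose N := maxn (size P) (size Q).
have leN : (size (P - Q)%R <= N)%N.
  by rewrite (leq_trans (size_polyD _ _)) // size_polyN.
have leP : (size P <= N)%N := leq_maxl _ _.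
have leQ : (size Q <= N)%N := leq_maxr _ _.
rewrite (lfunE leN) (lfunE leP) (lfunE leQ).
by rewrite -sumrB; apply: eq_bigr => k _; rewrite coefB mulrBl.
Qed.
HB.instance Definition _ := GRing.isZmodMorphism.Build _ _ lfun lfun_additive.

Lemma lfunCM f P : lfun (f%:P * P) = f * lfun P.
Proof.
have le : (size (f%:P * P)%R <= size P)%N.
  by rewrite mul_polyC size_scale_leq.
rewrite (lfunE le) mulr_sumr; apply: eq_bigr => k _.
by rewrite mul_polyC coefZ -mulrA.
Qed.

Lemma lfunXn k : lfun 'X^k = k`!%:R * q k.
Proof.
rewrite (@lfunE k.+1) ?size_polyXn // big_ord_recr /= coefXn eqxx mul1r big1 ?add0r //.
by move=> i _; rewrite coefXn ltn_eqF ?mul0r.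
Qed.

Lemma size_pd i P : (size (pd i P) <= size P)%N.
Proof. exact: size_poly. Qed.

Lemma size_deriv_leq P : (size P^`() <= size P)%N.
Proof. exact: leq_trans (size_poly _ _) (leq_pred _). Qed.

(** The extra term is the derivative falling on the variable that the contraction itself supplies in
    degree i + 1. Summed against [q i] it produces the contraction of P'. *)
Lemma d_lfun i P : d i (lfun P) = lfun (pd i P) + i.+1`!%:R * P`_i.+1.
Proof.
pose N := maxn (size P) i.+2.
have leP : (size P <= N)%N by rewrite leq_maxl.
have lepP : (size (pd i P) <= N)%N.
  exact: leq_trans (size_pd _ _) leP.
rewrite (lfunE leP) (lfunE lepP) linear_sum /=.
have -> : i.+1`!%:R * P`_i.+1 = \sum_(k < N) P`_k * (k`!%:R * (k == i.+1 :> nat)%:R).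
  have lti : (i.+1 < N)%N by rewrite leq_maxr.
  rewrite (bigD1 (Ordinal lti)) //= eqxx mulr1 big1 ?addr0 ?(mulrC _ P`_i.+1) // => k ki.
  rewrite (_ : _ == _ = false) ?mulr0 //; apply: contraNF ki => /eqP ki.
  exact/eqP/val_inj.
rewrite -big_split; apply: eq_bigr => k _ /=.
by rewrite !dM dq coef_pd der_nat; ring.
Qed.

(** * First- and second-order operators against the contraction *)

Definition bder N f : A := \sum_(m < N) q m * d m f.

Lemma bder_polyC N f : (bder N f)%:P = bop N f%:P.
Proof.
by rewrite /bder raddf_sum; apply: eq_bigr => i _; rewrite /= polyCM -pd_polyC.
Qed.

Lemma bder_lfun N P : (size P <= N)%N ->
  bder N (lfun P) = lfun (bop N P) + lfun P^`().
Proof.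
move=> leP; have leP' : (size P^`() <= N)%N by rewrite (leq_trans (size_deriv_leq _)).
rewrite (lfunE leP') /bder raddf_sum -big_split; apply: eq_bigr => m _ /=.
rewrite d_lfun lfunCM coef_deriv factS natrM -mulr_natl; ring.
Qed.

Definition d2der N f : A :=
  \sum_(k < N) \sum_(l < N) 'C(k + l, k)%:R *: (q (k + l) * d k (d l f)).

Definition d2op N P : {poly A} :=
  \sum_(k < N) \sum_(l < N) ('C(k + l, k)%:R * q (k + l))%:P * pd k (pd l P).

Lemma d2der_polyC N f : (d2der N f)%:P = d2op N f%:P.
Proof.
rewrite /d2der raddf_sum; apply: eq_bigr => k _; rewrite raddf_sum; apply: eq_bigr => l _ /=.
rewrite !pd_polyC -polyCM; congr _%:P.
by rewrite scaler_nat -[LHS]mulr_natl mulrA.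
Qed.

Lemma ifactM k l : ifact k * ifact l = 'C(k + l, k)%:R * ifact (k + l).
Proof.
have := bin_fact (leq_addr l k); rewrite addKn => /(congr1 (fun n => n%:R : A)).
rewrite !natrM => E.
transitivity ('C(k + l, k)%:R * ifact (k + l) * (k`!%:R * ifact k) * (l`!%:R * ifact l)).
  by rewrite -[LHS]mulr1 -[X in _ * X = _](factK (k + l)) -E; ring.
by rewrite !factK !mulr1.
Qed.

Lemma acoefM k l : acoef k * acoef l = 'C(k + l, k)%:R%:P * acoef (k + l).
Proof.
by rewrite /acoef [RHS]mulrA -polyCM -ifactM exprD polyCM; ring.
Qed.

(** The coefficient of d_k d_l in [d2op] is the contraction of [acoef k * acoef l], so commuting
    with a replaces it by the t-derivative of that product; the commutator is (a^2)' = 2 a' a. *)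
Lemma aop_d2op n N P : (n.*2 <= N)%N -> (forall i, (n <= i)%N -> pd i P = 0) ->
  aop N (d2op N P) = d2op N (aop N P) + adop N (aop N P) *+ 2.
Proof.
move=> leN P0.
transitivity (\sum_(k < N) \sum_(l < N) \sum_(i < N)
   (('C(k + l, k)%:R * q (k + l))%:P * acoef i * pd i (pd k (pd l P)))
  + \sum_(k < N) \sum_(l < N) \sum_(i < N)
   (acoef i * 'C(k + l, k)%:R%:P * (k + l == i.+1)%N%:R * pd k (pd l P))).
  rewrite -big_split /dop /=.
  under eq_bigr => i _ do rewrite raddf_sum mulr_sumr.
  rewrite exchange_big /=; apply: eq_bigr => k _; rewrite -big_split /=.
  under eq_bigr => i _ do rewrite raddf_sum mulr_sumr.
  rewrite exchange_big /=; apply: eq_bigr => l _; rewrite -big_split /=.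
  apply: eq_bigr => i _; rewrite pdM pd_polyC dM der_nat dq.
  by rewrite mul0r add0r polyCM polyC_natr polyCM; ring.
congr (_ + _).
  apply: eq_bigr => k _; apply: eq_bigr => l _; rewrite raddf_sum raddf_sum mulr_sumr.
  apply: eq_bigr => i _ /=; rewrite pdM pd_acoef mul0r add0r pdM pd_acoef mul0r add0r.
  by rewrite mulrA (pdC i) (pdC i).
rewrite mulr2n {2}adop_aop !dop_dop -big_split; apply: eq_bigr => k _ /=.
rewrite -big_split; apply: eq_bigr => l _ /=; rewrite !(pd_acoef, pd_acoef').
rewrite !mulr0 !mul0r !add0r -mulrDl -derivM -mulr_suml.
(* Outside k, l < n both sides vanish. Inside, the bound on N ensures that the index k + l - 1,
   whose derivation hits [q (k + l)], is within the truncation. *)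
have [le_nk|lt_kn] := leqP n k; first by rewrite pdC P0 ?raddf0 ?mulr0.
have [le_nl|lt_ln] := leqP n l; first by rewrite (P0 l) // raddf0 !mulr0.
congr (_ * _); rewrite acoefM deriv_mulC.
case Ekl: (k + l)%N => [|j].
  by rewrite acoef0' mulr0 big1 // => i _; rewrite mulr0.
have ltj : (j < N)%N by move: leN Ekl lt_kn lt_ln; rewrite -addnn; lia.
rewrite acoefS' (bigD1 (Ordinal ltj)) //= eqxx mulr1 big1 ?addr0 1?mulrC // => i ij.
rewrite (_ : _ == _ = false) ?mulr0 //; apply: contraNF ij => /eqP[ij].
exact/eqP/val_inj.
Qed.

Lemma lfun_acoefM N l P : (size P <= N)%N ->
  lfun (acoef l * P) = \sum_(k < N) P`_k * ('C(k + l, k)%:R * k`!%:R * q (k + l)).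
Proof.
move=> leP; have EP : P = \sum_(k < N) (P`_k)%:P * 'X^k.
  apply/polyP => j; rewrite coef_sum; have [leN|ltN] := leqP N j.
    rewrite nth_default ?(leq_trans leP) // big1 // => k _.
    by rewrite coefCM coefXn gtn_eqF ?mulr0 // (leq_trans (ltn_ord k)).
  rewrite (bigD1 (Ordinal ltN)) //= coefCM coefXn eqxx mulr1 big1 ?addr0 // => k kj.
  rewrite coefCM coefXn (_ : _ == _ = false) ?mulr0 //.
  by apply: contraNF kj => /eqP jk; apply/eqP/val_inj.
rewrite {1}EP mulr_sumr raddf_sum; apply: eq_bigr => k _ /=.
have -> : acoef l * ((P`_k)%:P * 'X^k) = (ifact l * P`_k)%:P * 'X^(k + l).
  by rewrite /acoef polyCM exprD; ring.
have := bin_fact (leq_addr l k); rewrite addKn => E.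
rewrite lfunCM lfunXn -E !natrM -[RHS]mulr1 -[X in _ = _ * X](factK l); ring.
Qed.

(** Two derivatives cannot both fall on the single variable supplied by the contraction. The mixed
    terms, one derivative on it and one on the coefficient, are symmetric in k and l, whence the
    factor 2. *)
Lemma d2der_lfun N P : (size P <= N)%N ->
  d2der N (lfun P) = lfun (d2op N P) + lfun (aop N P^`()) *+ 2.
Proof.
move=> leP; have leP' l : (size (pd l P^`()) <= N)%N.
  exact: leq_trans (size_pd _ _) (leq_trans (size_deriv_leq _) leP).
transitivity (lfun (d2op N P)
  + \sum_(k < N) \sum_(l < N) 'C(k + l, k)%:R * k.+1`!%:R * q (k + l) * d l P`_k.+1
  + \sum_(k < N) \sum_(l < N) 'C(k + l, k)%:R * l.+1`!%:R * q (k + l) * d k P`_l.+1).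
  rewrite raddf_sum -!big_split; apply: eq_bigr => k _ /=.
  rewrite raddf_sum -!big_split; apply: eq_bigr => l _ /=.
  rewrite lfunCM d_lfun linearD /= d_lfun dM der_nat coef_pd scaler_nat -mulr_natl.
  by ring.
rewrite -addrA; congr (_ + _); rewrite [X in _ + X]exchange_big mulr2n.
have -> : lfun (aop N P^`()) = \sum_(k < N) \sum_(l < N)
    'C(k + l, k)%:R * k.+1`!%:R * q (k + l) * d l P`_k.+1.
  rewrite raddf_sum exchange_big; apply: eq_bigr => l _ /=.
  rewrite (lfun_acoefM _ (leP' l)); apply: eq_bigr => k _.
  by rewrite coef_pd coef_deriv raddfMn /= factS natrM -mulr_natl; ring.
congr (_ + _); apply: eq_bigr => k _; apply: eq_bigr => l _.
by rewrite (addnC l k) -[in RHS](bin_sub (leq_addr l k)) addKn.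
Qed.

Section Bounded.
Variables (n : nat) (f : A).
Hypothesis f_bnd : forall i, (n <= i)%N -> d i f = 0.

Lemma pd_iter_aop m N i : (n <= i)%N -> pd i (iter m (aop N) f%:P) = 0.
Proof.
move=> le; elim: m => [|m IH] /=; first by rewrite pd_polyC f_bnd.
rewrite raddf_sum big1 // => j _ /=.
by rewrite pdM pd_acoef mul0r add0r pdC IH raddf0 mulr0.
Qed.

(** This avoids a circular choice: N has to exceed the degree of the symbol, and that degree can be
    measured at the truncation n, before N is fixed. *)
Lemma iter_aop_trunc m N : (n <= N)%N ->
  iter m (aop N) f%:P = iter m (aop n) f%:P.
Proof.
move=> leN; elim: m => //= m ->.
rewrite /dop -!(big_mkord xpredT (fun i => acoef i * pd i _)).
rewrite (big_cat_nat (leq0n _) leN) /=.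
rewrite [X in _ + X]big_nat_cond [X in _ + X]big1 ?addr0 // => i.
by rewrite andbT => /andP[lei _]; rewrite pd_iter_aop // mulr0.
Qed.

Lemma iter_aop_d2op m N : (n.*2 <= N)%N ->
  iter m (aop N) (d2op N f%:P)
  = d2op N (iter m (aop N) f%:P) + adop N (iter m (aop N) f%:P) *+ m *+ 2.
Proof.
move=> leN; elim: m => [|m IH]; first by rewrite mul0rn addr0.
rewrite iterS IH raddfD !raddfMn /= (@aop_d2op n) //; last first.
  by move=> i; apply: pd_iter_aop.
by rewrite -adop_aop -addrA -mulrnDl -mulrS.
Qed.

(** The derivative term of [bder_lfun] is exactly the one of [iter_aop_bop]. *)
Lemma bder_lfun_iter m N :
    (n <= N)%N -> (size (iter m (aop n) f%:P) <= N)%N ->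
  bder N (lfun (iter m (aop N) f%:P)) = lfun (iter m (aop N) (bder N f)%:P).
Proof.
move=> leN; rewrite -(iter_aop_trunc _ leN) => leS.
by rewrite bder_lfun // bder_polyC iter_aop_bop raddfD.
Qed.

(** The defect 2 a P' of [d2der_lfun] with P = a^m f equals 2m a' a^m f by [aop_deriv_iter], which
    is the defect of [iter_aop_d2op]. *)
Lemma d2der_lfun_iter m N :
    (n.*2 <= N)%N -> (size (iter m (aop n) f%:P) <= N)%N ->
  d2der N (lfun (iter m (aop N) f%:P)) = lfun (iter m (aop N) (d2der N f)%:P).
Proof.
move=> leN; have leN1 : (n <= N)%N by rewrite (leq_trans _ leN) // -addnn leq_addr.
rewrite -(iter_aop_trunc _ leN1) => leS.
by rewrite d2der_lfun // d2der_polyC iter_aop_d2op // raddfD raddfMn aop_deriv_iter.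
Qed.
End Bounded.

(** Only the coefficient t^0/0! of a(t) meets [q 1], so a sends it to 1 and the Leibniz rule stops
    after one step. *)
Lemma iter_aop_q1 m N P : (0 < N)%N ->
  iter m (aop N) ((q 1)%:P * P)
  = (q 1)%:P * iter m (aop N) P + iter m.-1 (aop N) P *+ m.
Proof.
case: N => // N _; have aq : aop N.+1 (q 1)%:P = 1.
  rewrite /dop big_ord_recl big1 ?addr0 => [|i _]; last first.
    by rewrite pd_polyC dq mulr0.
  by rewrite pd_polyC dq mulr1 /acoef expr0 mulr1 /ifact invr1 scale1r.
elim: m => [|[|m] IH]; first by rewrite mulr0n addr0.
  by rewrite /= dopM aq mul1r addrC.
rewrite iterS IH raddfD raddfMn /= dopM aq mul1r (addrC _ (_ * _)) -addrA.
by rewrite [in RHS]mulrS.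
Qed.

Lemma sum_tuple_cons (V : nmodType) m N (G : m.+1.-tuple 'I_N -> V) :
  \sum_t G t = \sum_(i < N) \sum_(t : m.-tuple 'I_N) G [tuple of i :: t].
Proof.
rewrite pair_bigA /=.
rewrite (reindex (fun p : 'I_N * m.-tuple 'I_N => [tuple of p.1 :: p.2])) //=.
exists (fun t => (thead t, [tuple of behead t])) => [[i t] _|t _] /=.
  by congr (_, _); apply: val_inj.
by rewrite [RHS]tuple_eta.
Qed.

Lemma pd_prod_acoef i s : pd i (\prod_(j <- s) acoef j) = 0.
Proof.
elim: s => [|j s IH]; first by rewrite big_nil pd_polyC der1.
by rewrite big_cons pdM IH pd_acoef mulr0 mul0r addr0.
Qed.

Lemma iter_aop_tuple m N f :
  iter m (aop N) f%:P = \sum_(t : m.-tuple 'I_N)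
    (\prod_(i <- map val t) acoef i) * (foldr (fun i => d i) f (map val t))%:P.
Proof.
elim: m => [|m IH].
  rewrite (big_pred1 [tuple]) /= ?big_nil ?mul1r // => t.
  by apply/esym/eqP/val_inj; rewrite (tuple0 t).
rewrite iterS IH sum_tuple_cons; apply: eq_bigr => i _.
rewrite raddf_sum mulr_sumr; apply: eq_bigr => t _ /=.
by rewrite big_cons pdM pd_prod_acoef mul0r add0r pd_polyC mulrA.
Qed.

Lemma algM (c e : rat) : (c * e)%:A = c%:A * e%:A :> A.
Proof. by rewrite -scalerAl mul1r scalerA. Qed.

Lemma prod_acoef s : \prod_(i <- s) acoef i
  = (((\prod_(i <- s) i`!%:R)^-1 : rat)%:A)%:P * 'X^(sumn s).
Proof.
elim: s => [|i s IH] /=; first by rewrite !big_nil invr1 scale1r mulr1.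
rewrite !big_cons IH exprD /acoef invfM algM polyCM /ifact.
set x := (_ %:A)%:P; set y := (_ %:A)%:P; ring.
Qed.

Lemma lfun_iter_aop m N f :
  lfun (iter m (aop N) f%:P) = \sum_(t : m.-tuple 'I_N) let s := map val t in
    multinomial s *: (q (sumn s) * foldr (fun i => d i) f s).
Proof.
rewrite iter_aop_tuple raddf_sum; apply: eq_bigr => t _ /=; set s := map val t.
rewrite prod_acoef mulrAC -polyCM lfunCM lfunXn -[RHS]mulr_algl /multinomial algM.
rewrite scaler_nat; set x := _ %:A; ring.
Qed.

Definition laplace N f : A := 2^-1 *: (d2der N f - bder N (bder N f)).

(** * Action on powers of [q 2]: [y r] models Q_2^r and [S] models the polynomial ring R *)

Section LeadingTerm.
Variables (S : A -> Prop) (y : rat -> A).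
Hypotheses (S0 : S 0) (SD : forall f g, S f -> S g -> S (f + g)).
Hypotheses (SM : forall f g, S f -> S g -> S (f * g)) (SZ : forall c : rat, S c%:A).
Hypotheses (Sd : forall i f, S f -> S (d i f)) (Sq : forall m, S (q m)).
Hypotheses (yS : forall r, y r = y (r - 1) * q 2).
Hypothesis dy : forall i r, d i (y r) = (i == 1)%:R * (r *: y (r - 1)).

Let Sp P := forall k, S P`_k.

Let SpD P Q : Sp P -> Sp Q -> Sp (P + Q).
Proof. by move=> SP SQ k; rewrite coefD; apply: SD. Qed.

Let SpM P Q : Sp P -> Sp Q -> Sp (P * Q).
Proof.
by move=> SP SQ k; rewrite coefM; apply: (big_ind S) => // i _; apply: SM.
Qed.

Let SpC f : S f -> Sp f%:P.
Proof. by move=> Sf k; rewrite coefC; case: eqP. Qed.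

Let SpXn k : Sp 'X^k.
Proof. by move=> j; rewrite coefXn -[X in S X]scaler_nat. Qed.

Let Spa N P : Sp P -> Sp (aop N P).
Proof.
move=> SP; apply: (big_ind Sp) => [k||i _]; [by rewrite coef0|exact: SpD|].
apply: SpM; last by move=> k; rewrite coef_pd; apply: Sd.
by apply: SpM (SpXn _); apply: SpC; apply: SZ.
Qed.

Lemma S_lfun P : Sp P -> S (lfun P).
Proof.
move=> SP; apply: (big_ind S) => // k _; apply: SM => //; apply: SM => //.
by rewrite -scaler_nat.
Qed.

(* Differentiating a power of [q 2] costs one factor [q 2] and multiplies the
   symbol by [t]; all other terms keep that factor. *)
Lemma iter_aop_lead m N r f : (1 < N)%N -> S f -> exists2 H, Sp H &
  iter m (aop N) (y r * f)%:P = (y (r - m%:R))%:P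
    * ((\prod_(j < m) (r - j%:R))%:A%:P * f%:P * 'X^m + (q 2)%:P * H).
Proof.
case: N => [|[|N]] // _ Sf.
have ay u : aop N.+2 (y u)%:P = (y (u - 1))%:P * (u%:A%:P * 'X).
  rewrite /dop 2!big_ord_recl big1 ?addr0 => [|i _]; last first.
    by rewrite pd_polyC dy mul0r mulr0.
  rewrite !pd_polyC !dy mul0r mulr0 add0r mul1r /acoef /ifact invr1 scale1r.
  by rewrite mul1r -[u *: y _]mulr_algl polyCM expr1; ring.
elim: m => [|m [H SH E]].
  exists 0 => [k|]; first by rewrite coef0.
  by rewrite big_ord0 scale1r expr0 mulr0 subr0 addr0 mul1r mulr1 polyCM.
pose c := \prod_(j < m) (r - j%:R).
pose u := r - m%:R; pose W := (c%:A%:P * f%:P * 'X^m + (q 2)%:P * H).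
exists (u%:A%:P * 'X * H + aop N.+2 W).
  apply: SpD; first by apply: SpM => //; apply: SpM (SpXn 1); apply: SpC.
  apply/Spa/SpD; last by apply: SpM => //; apply: SpC.
  by apply: SpM => //; apply: SpM; apply: SpC.
rewrite iterS E dopM ay -/c -/u -/W big_ord_recr /= -/c -/u algM [y u]yS.
have -> : r - m.+1%:R = u - 1 by rewrite /u -natr1 opprD addrA.
rewrite {1}/W exprS !polyCM; ring.
Qed.

Lemma lfun_iter_lead m N r f : (1 < N)%N -> S f -> exists2 h, S h &
  lfun (iter m (aop N) (y r * f)%:P) = y (r - m%:R)
    * (((\prod_(j < m) (r - j%:R)) * m`!%:R) *: (q m * f) + q 2 * h).
Proof.
move=> ltN Sf; have [H SH ->] := iter_aop_lead m r ltN Sf.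
exists (lfun H); first exact: S_lfun.
rewrite lfunCM raddfD /= -polyCM !lfunCM lfunXn -[in RHS]mulr_algl algM scaler_nat.
by congr (_ * (_ + _)); ring.
Qed.

Lemma sum_eq_nat N j (F : nat -> A) : (j < N)%N ->
  \sum_(i < N) (i == j :> nat)%:R * F i = F j.
Proof.
move=> ltN; rewrite (bigD1 (Ordinal ltN)) //= eqxx mul1r big1 ?addr0 // => i ij.
rewrite (_ : _ == _ = false) ?mul0r //; apply: contraNF ij => /eqP ij.
exact/eqP/val_inj.
Qed.

(** Only d 1 sees [y r]. If both derivatives hit it, then k = l = 1, with binomial 2; if one does,
    the binomial C(l+1, 1) turns the other into the Euler operator, which measures weight. *)
Lemma d2der_y N r f : (1 < N)%N ->
  d2der N (y r * f) = y r * d2der N f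
    + (2 * (r * (r - 1))) *: (y (r - 2) * (q 2 * f))
    + (2 * r) *: (y (r - 1) * \sum_(l < N) l.+1%:R * (q l.+1 * d l f)).
Proof.
move=> ltN; pose y1 := r *: y (r - 1); pose y2 := r *: ((r - 1) *: y (r - 2)).
pose U k l := 'C(k + l, k)%:R * q (k + l) * (y1 * d l f).
pose W k l := 'C(k + l, k)%:R * q (k + l) * (y2 * f).
have dy1 i : d i y1 = (i == 1)%:R * y2.
  rewrite linearZ /= dy scalerAr /y2; congr (_ * (_ *: (_ *: y _))).
  by rewrite -addrA -opprD.
have ddy k l : d k (d l (y r * f)) = (k == 1)%:R * ((l == 1)%:R * (y2 * f))
    + (k == 1)%:R * (y1 * d l f) + (l == 1)%:R * (y1 * d k f) + y r * d k (d l f).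
  by rewrite (dM l) (dy l) -/y1 linearD /= !dM der_nat dy1 dy -/y1; ring.
transitivity (y r * d2der N f + \sum_(k < N) (k == 1 :> nat)%:R
      * (\sum_(l < N) ((l == 1 :> nat)%:R * W k l + U k l))
  + \sum_(k < N) \sum_(l < N) (l == 1 :> nat)%:R * U l k).
  rewrite mulr_sumr -!big_split; apply: eq_bigr => k _ /=.
  rewrite !mulr_sumr -!big_split; apply: eq_bigr => l _ /=.
  rewrite ddy /U /W (addnC l k) -(bin_sub (leq_addl k l)) addnK !scaler_nat.
  ring.
rewrite [X in _ + X]exchange_big /=.
rewrite (sum_eq_nat (fun k => \sum_(l < N) ((l == 1 :> nat)%:R * W k l + U k l))) //.
have -> : \sum_(l < N) \sum_(k < N) (l == 1 :> nat)%:R * U l k = \sum_(k < N) U 1%N k.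
  under eq_bigr => l _ do rewrite -mulr_sumr.
  by rewrite (sum_eq_nat (fun l => \sum_(k < N) U l k)).
rewrite big_split /= (sum_eq_nat (W 1%N)) // -!addrA; congr (_ + (_ + _)).
  rewrite /W bin1 /y2 -[in RHS]mulr_algl !algM -[r *: (_ *: _)]mulr_algl.
  by rewrite -[(r - 1) *: y _]mulr_algl scaler_nat; ring.
rewrite -mulr2n -[LHS]mulr_natl -[in RHS]mulr_algl algM scaler_nat.
rewrite -!mulrA; congr (_ * _); rewrite !mulr_sumr; apply: eq_bigr => l _.
by rewrite /U /y1 -[r *: y _]mulr_algl bin1 add1n; ring.
Qed.

Lemma bderM N f g : bder N (f * g) = bder N f * g + f * bder N g.
Proof.
rewrite /bder mulr_suml mulr_sumr -big_split; apply: eq_bigr => i _ /=.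
by rewrite dM; ring.
Qed.

Lemma bder_y N r : (1 < N)%N -> bder N (y r) = q 1 * (r *: y (r - 1)).
Proof.
move=> ltN; rewrite -(sum_eq_nat (fun i => q i * (r *: y (r - 1))) ltN).
by apply: eq_bigr => i _; rewrite dy mulrCA.
Qed.

Lemma bder_yM N r f : (1 < N)%N ->
  bder N (y r * f) = y (r - 1) * (q 1 * (r *: f) + q 2 * bder N f).
Proof.
move=> ltN; rewrite bderM bder_y // [y r]yS -[r *: y _]mulr_algl -[r *: f]mulr_algl.
ring.
Qed.

(** The coefficient 2r(r - 3/2) is 2r(r - 1) from [d2der_y] minus r, which arises in the second
    [bder] from [bder N (q 1) = 1]. Everything else that is new is collected as a multiple of
    [q 1]. *)
Lemma laplace_y N r f : (1 < N)%N -> q 0 = 1 ->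
  d2der N (y r * f) - bder N (bder N (y r * f))
  = y r * (d2der N f - bder N (bder N f))
    + (2 * (r * (r - 3 / 2))) *: (y (r - 1) * f)
    + (2 * r) *: (y (r - 1) * \sum_(l < N) l.+1%:R * (q l.+1 * d l f))
    - 2 *: (q 1 * (r *: (y (r - 1) * bder N f)
                   + (r * (r - 1) / 2) *: (y (r - 2) * (q 1 * f)))).
Proof.
move=> ltN q0; rewrite d2der_y //; set E := \sum_(l < N) _.
have bq1 : bder N (q 1) = 1.
  case: (N) ltN => // n _; rewrite /bder big_ord_recl q0 mul1r dq big1 ?addr0 //.
  by move=> i _; rewrite dq mulr0.
have bZ c g : bder N (c *: g) = c *: bder N g.
  by rewrite scaler_sumr; apply: eq_bigr => i _; rewrite linearZ /= scalerAr.
have y2 : r - 1 - 1 = r - 2 by rewrite -addrA -opprD.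
have bD g h : bder N (g + h) = bder N g + bder N h.
  by rewrite -big_split; apply: eq_bigr => i _; rewrite linearD mulrDr.
have -> : 2 * (r * (r - 3 / 2)) = 2 * (r * (r - 1)) - r by lra.
have -> : 2 *: (q 1 * (r *: (y (r - 1) * bder N f)
      + (r * (r - 1) / 2) *: (y (r - 2) * (q 1 * f))))
    = (2 * r) *: (q 1 * (y (r - 1) * bder N f))
      + (r * (r - 1)) *: (q 1 * (y (r - 2) * (q 1 * f))).
  rewrite mulrDr scalerDr -!scalerAr !scalerA; by congr (_ + _ *: _); lra.
rewrite bderM bD !bderM !bder_y // bderM bq1 bZ bder_y // y2 (yS (r - 1)) y2.
rewrite -!(mulr_algl _ (_ * _)) -!(mulr_algl _ (y _)) !algM.
have -> : (2 * (r * (r - 1)) - r)%:A = 2%:A * (r%:A * (r - 1)%:A) - r%:A :> A.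
  by rewrite scalerBl !algM.
by rewrite !scaler_nat; ring.
Qed.

Lemma laplace_homog_y N r w f : (1 < N)%N -> q 0 = 1 ->
    \sum_(l < N) l.+1%:R * (q l.+1 * d l f) = w *: f ->
  laplace N (y r * f) = y r * laplace N f + (r * (w + r - 3 / 2)) *: (y (r - 1) * f)
    - q 1 * (r *: (y (r - 1) * bder N f)
             + (r * (r - 1) / 2) *: (y (r - 2) * (q 1 * f))).
Proof.
move=> ltN q0 E; rewrite /laplace laplace_y // E; set X := q 1 * _.
move: (d2der N f - _) X => Z X.
rewrite scalerBr !scalerDr -!scalerAr !scalerA mulVf // scale1r; congr (_ - _).
by rewrite -addrA -scalerDl; congr (_ + _ *: _); lra.
Qed.
End LeadingTerm.

Lemma lfun_acoefC i f : lfun (acoef i * f%:P) = q i * f.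
Proof.
rewrite /acoef mulrAC -polyCM lfunCM lfunXn.
transitivity (i`!%:R * ifact i * (q i * f)); first by ring.
by rewrite factK mul1r.
Qed.

Lemma lfun_aop N f : lfun (aop N f%:P) = bder N f.
Proof.
by rewrite /dop raddf_sum; apply: eq_bigr => i _ /=; rewrite pd_polyC lfun_acoefC.
Qed.

Lemma lfun_aop2 N f : lfun (aop N (aop N f%:P)) = d2der N f.
Proof.
rewrite dop_dop raddf_sum; apply: eq_bigr => k _; rewrite raddf_sum; apply: eq_bigr => l _ /=.
rewrite pd_acoef mulr0 mul0r add0r acoefM -mulrA lfunCM !pd_polyC lfun_acoefC.
by rewrite mulr_natl scaler_nat.
Qed.
End SymbolCalculus.
(** * The operators on the ring of the Q_i *)

Definition dQ i : {linear qalg -> qalg} := pder i.+1.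

Lemma dQM i f g : dQ i (f * g) = dQ i f * g + f * dQ i g.
Proof. exact: pderM. Qed.

Lemma dQC i j f : dQ i (dQ j f) = dQ j (dQ i f).
Proof. exact: pderC. Qed.

Lemma dQ_qvar i m : dQ i (qvar m) = (m == i.+1)%:R.
Proof. exact: pder_qvar. Qed.

Lemma dQ_nvars f i : (nvars f <= i)%N -> dQ i f = 0.
Proof. by move=> le; apply: pder_nvars. Qed.

Definition symb N m f := lfun qvar (iter m (dop dQ (@acoef qalg) N) f%:P).

Lemma scrD_symb m f N : (nvars f <= N)%N -> scrD m f = symb N m f.
Proof. by move=> leN; rewrite (scrDE m leN) /symb (lfun_iter_aop qvar dQM). Qed.

Lemma bpartial_bder f N : (nvars f <= N)%N -> bpartial f = bder dQ qvar N f.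
Proof. exact: bpartialE. Qed.

Lemma calD_d2der f N : (nvars f <= N)%N -> calD f = d2der dQ qvar N f.
Proof. exact: calDE. Qed.

Lemma pders_linear s : linear (pders s).
Proof.
move=> c f g; elim: s => [//|i s IH] /=; first by rewrite IH linearP.
Qed.

(** The range [nvars] depends on the argument, so the three sums are first extended to a common
    range; the same is done for [bpartial] and [calD]. *)
Fact scrD_linear m : linear (scrD m).
Proof.
move=> c f g; pose N := maxn (nvars (c *: f + g)) (maxn (nvars f) (nvars g)).
rewrite !(@scrDE m _ N) ?leq_max ?leqnn ?orbT // scaler_sumr -big_split.
apply: eq_bigr => t _ /=; rewrite pders_linear mulrDr scalerDr -scalerAr.
by rewrite !scalerA mulrC.
Qed.
HB.instance Definition _ m :=
  GRing.isLinear.Build rat qalg qalg *:%R (scrD m) (scrD_linear m).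

Fact bpartial_linear : linear bpartial.
Proof.
move=> c f g; pose N := maxn (nvars (c *: f + g)) (maxn (nvars f) (nvars g)).
rewrite !(@bpartialE _ N) ?leq_max ?leqnn ?orbT // scaler_sumr -big_split.
by apply: eq_bigr => t _ /=; rewrite linearP mulrDr -scalerAr.
Qed.
HB.instance Definition _ :=
  GRing.isLinear.Build rat qalg qalg *:%R bpartial bpartial_linear.

Fact calD_linear : linear calD.
Proof.
move=> c f g; pose N := maxn (nvars (c *: f + g)) (maxn (nvars f) (nvars g)).
rewrite !(@calDE _ N) ?leq_max ?leqnn ?orbT // scaler_sumr -big_split.
apply: eq_bigr => k _ /=; rewrite scaler_sumr -big_split; apply: eq_bigr => l _ /=.
by rewrite !linearP mulrDr scalerDr -scalerAr !scalerA mulrC.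
Qed.
HB.instance Definition _ :=
  GRing.isLinear.Build rat qalg qalg *:%R calD calD_linear.

Lemma bpartial_scrD m f : bpartial (scrD m f) = scrD m (bpartial f).
Proof.
(* N bounds the variables of every element to which a truncated operator is applied, and the degree
   of the symbol, as [bder_lfun] requires. *)
pose n := nvars f; pose N := (n + nvars (scrD m f) + nvars (bpartial f)
  + size (iter m (dop dQ (@acoef qalg) n) f%:P))%N.
have fN : (nvars f <= N)%N by rewrite /N; lia.
have lN : (size (iter m (dop dQ (@acoef qalg) n) f%:P) <= N)%N by rewrite leq_addl.
have DN : (nvars (scrD m f) <= N)%N by rewrite /N; lia.
have bN : (nvars (bpartial f) <= N)%N by rewrite /N; lia.
rewrite (bpartial_bder DN) (scrD_symb m bN) (scrD_symb m fN) (bpartial_bder fN).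
exact: (bder_lfun_iter dQM dQC dQ_qvar (@dQ_nvars f)).
Qed.

Lemma calD_scrD m f : calD (scrD m f) = scrD m (calD f).
Proof.
pose n := nvars f; pose N := (n + n + nvars (scrD m f) + nvars (calD f)
  + size (iter m (dop dQ (@acoef qalg) n) f%:P))%N.
have fN : (nvars f <= N)%N by rewrite /N; lia.
have fN2 : ((nvars f).*2 <= N)%N by rewrite /N; lia.
have lN : (size (iter m (dop dQ (@acoef qalg) n) f%:P) <= N)%N by rewrite leq_addl.
have DN : (nvars (scrD m f) <= N)%N by rewrite /N; lia.
have bN : (nvars (calD f) <= N)%N by rewrite /N; lia.
rewrite (calD_d2der DN) (scrD_symb m bN) (scrD_symb m fN) (calD_d2der fN).
exact: (d2der_lfun_iter dQM dQC dQ_qvar (@dQ_nvars f)).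
Qed.

Lemma scrD_q1 m f :
  scrD m (qvar 1 * f) = qvar 1 * scrD m f + scrD m.-1 f *+ m.
Proof.
pose N := (nvars (qvar 1 * f)%R + nvars f + 1)%N.
have fN : (nvars f <= N)%N by rewrite /N; lia.
have qN : (nvars (qvar 1 * f)%R <= N)%N by rewrite /N; lia.
rewrite (scrD_symb m qN) !(scrD_symb _ fN) /symb polyCM.
rewrite (iter_aop_q1 dQM dQ_qvar m f%:P (ltn_addl _ (ltn0Sn 0))) raddfD raddfMn /=.
by rewrite lfunCM.
Qed.

Lemma scrD0 f : scrD 0 f = f.
Proof. by rewrite (scrD_symb 0 (leqnn _)) /symb /= -[f%:P]mulr1 lfunCM -(expr0 'X) lfunXn !mulr1. Qed.

Lemma scrD1 f : scrD 1 f = bpartial f.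
Proof.
rewrite (scrD_symb 1 (leqnn _)) (bpartial_bder (leqnn _)) /symb /=.
exact: lfun_aop.
Qed.

Lemma scrD2 f : scrD 2 f = calD f.
Proof.
rewrite (scrD_symb 2 (leqnn _)) (calD_d2der (leqnn _)) /symb /=.
exact: (lfun_aop2 qvar dQM).
Qed.

(** Since scrD_1 is bpartial, Delta_2 = calD - 2 bpartial^2 + bpartial^2. *)
Lemma Delta_2 f : Delta f = 2^-1 *: Delta_ 2 f.
Proof.
rewrite /Delta /Delta_ !big_ord_recl big_ord0 /= scrD2 scrD1 scrD0 !scale1r addr0.
congr (_ *: (_ + _)); rewrite (_ : _ * _ = - 2%:R) // scaleNr scaler_nat mulr2n.
by rewrite opprD -addrA addNr addr0.
Qed.

Fact Delta__linear m : linear (Delta_ m).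
Proof.
have itl i : linear (iter i bpartial).
  by move=> c f g; elim: i => //= i ->; rewrite linearP.
move=> c f g; rewrite /Delta_ scaler_sumr -big_split; apply: eq_bigr => i _ /=.
by rewrite itl linearP scalerDr !scalerA mulrC.
Qed.
HB.instance Definition _ m :=
  GRing.isLinear.Build rat qalg qalg *:%R (Delta_ m) (Delta__linear m).

Fact Delta_linear : linear Delta.
Proof. by move=> c f g; rewrite !Delta_2 linearP scalerDr !scalerA mulrC. Qed.
HB.instance Definition _ :=
  GRing.isLinear.Build rat qalg qalg *:%R Delta Delta_linear.

Lemma Delta_scrD m f : Delta (scrD m f) = scrD m (Delta f).
Proof. by rewrite /Delta calD_scrD !bpartial_scrD [RHS]linearZ /= [in RHS]linearB. Qed.

Lemma Delta_bpartial f : Delta (bpartial f) = bpartial (Delta f).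
Proof. by rewrite -!scrD1 Delta_scrD. Qed.

Lemma Delta_Delta_ m f : Delta (Delta_ m f) = Delta_ m (Delta f).
Proof.
have itD i : Delta (iter i bpartial f) = iter i bpartial (Delta f).
  by elim: i => //= i <-; rewrite Delta_bpartial.
rewrite linear_sum; apply: eq_bigr => i _ /=.
by rewrite linearZ /= Delta_scrD itD.
Qed.

Lemma iter_bpartial_q1 i f :
  iter i bpartial (qvar 1 * f)
  = qvar 1 * iter i bpartial f + iter i.-1 bpartial f *+ i.
Proof.
have bq g : bpartial (qvar 1 * g) = qvar 1 * bpartial g + g.
  by rewrite -!scrD1 scrD_q1 scrD0.
elim: i => [|[|i] IH]; first by rewrite mulr0n addr0.
  by rewrite /= bq.
by rewrite iterS IH linearD linearMn /= bq -addrA [in RHS]mulrS.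
Qed.

(** The summand is the defect of moving Q_1 past D_(m-i) bpartial^i. As C(m,i)(m-i) = C(m,i+1)(i+1),
    the first half at i cancels the second half at i + 1. The truncated predecessors at the two ends
    carry the factor 0. *)
Lemma telescope_binomial (V : lmodType rat) m (T : nat -> nat -> V) :
  \sum_(i < m.+1) ((-1) ^+ i * 'C(m, i)%:R)
    *: (T (m - i).-1 i *+ (m - i) + T (m - i)%N i.-1 *+ i) = 0.
Proof.
pose F i := ((-1) ^+ i * ('C(m, i) * (m - i))%:R) *: T (m - i).-1 i.
pose G i := ((-1) ^+ i * ('C(m, i) * i)%:R) *: T (m - i)%N i.-1.
transitivity (\sum_(i < m.+1) (F i + G i)).
  apply: eq_bigr => i _; rewrite scalerDr -!scaler_nat !scalerA /F /G.
  by rewrite !natrM !mulrA.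
rewrite big_split /= big_ord_recr [X in _ + X]big_ord_recl /=.
have -> : F m = 0 by rewrite /F subnn muln0 mulr0 scale0r.
have -> : G 0%N = 0 by rewrite /G muln0 mulr0 scale0r.
rewrite addr0 add0r -big_split big1 // => i _; rewrite /F /G /= /bump add1n.
rewrite -subnS [('C(m, i) * _)%N]mulnC -mul_bin_left (mulnC i.+1) exprS mulN1r.
by rewrite mulNr scaleNr addrN.
Qed.

Lemma Delta__q1 m f : Delta_ m (qvar 1 * f) = qvar 1 * Delta_ m f.
Proof.
pose T a i := scrD a (iter i bpartial f).
rewrite -[RHS]addr0 -(telescope_binomial m T) /Delta_ mulr_sumr -big_split.
apply: eq_bigr => i _ /=; rewrite -(scalerAr _ (qvar 1)) -[RHS]scalerDr; congr (_ *: _).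
by rewrite iter_bpartial_q1 linearD linearMn /= scrD_q1 addrA.
Qed.

Lemma Delta_q1 f : Delta (qvar 1 * f) = qvar 1 * Delta f.
Proof. by rewrite !Delta_2 Delta__q1 scalerAr. Qed.

(** * Rings and gradings as conditions on the support *)

Section SupportClosure.
Implicit Types (P : {pred expo}) (f g : qalg) (e : expo).

Definition supported P : {pred qalg} := fun f => all P (msupp f).

Lemma supported0 P : 0 \in supported P.
Proof. by rewrite unfold_in msupp0. Qed.

Lemma supported_mono P e : (mono e \in supported P) = P e.
Proof.
rewrite [LHS]unfold_in msuppU oner_eq0.
apply/allP/idP => [eR|eR e' /fset1P-> //].
by apply: eR; rewrite fset11.
Qed.

Lemma supportedP P c f g :
  f \in supported P -> g \in supported P -> c *: f + g \in supported P.
Proof.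
move=> /allP fR /allP gR; apply/allP => e /(fsubsetP (msuppD_le _ _)).
by rewrite in_fsetU => /orP[/(fsubsetP (msuppZ_le _ _))/fR|/gR].
Qed.

Lemma supportedD P f g :
  f \in supported P -> g \in supported P -> f + g \in supported P.
Proof. by move=> fP gP; rewrite -[f]scale1r supportedP. Qed.

Lemma supportedZ P c f : f \in supported P -> c *: f \in supported P.
Proof. by move=> fP; rewrite -[_ *: f]addr0 supportedP ?supported0. Qed.

Lemma supportedN P f : f \in supported P -> - f \in supported P.
Proof. by rewrite -scaleN1r; apply: supportedZ. Qed.

Lemma supported_sum P (I : Type) (r : seq I) (Q : pred I) (F : I -> qalg) :
  (forall i, Q i -> F i \in supported P) -> \sum_(i <- r | Q i) F i \in supported P.
Proof.
move=> FP; apply: (big_ind (fun f => f \in supported P)) => //.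
  exact: supported0.
exact: supportedD.
Qed.

Lemma supported_ind P (K : qalg -> Prop) : K 0 ->
  (forall e, P e -> K (mono e)) -> (forall c f g, K f -> K g -> K (c *: f + g)) ->
  forall f, f \in supported P -> K f.
Proof.
move=> K0 Km KD f /allP fP; rewrite (qalgE f) big_seq.
by apply: (big_rec K) => // e g /fP/Km Ke Kg; apply: KD.
Qed.

Lemma supported_linext P P' (F : expo -> qalg) f :
  (forall e, P e -> F e \in supported P') -> f \in supported P ->
  linext F f \in supported P'.
Proof.
move=> FP; elim/supported_ind => [|e Pe|c g h gP hP]; rewrite ?linear0 ?supported0 //.
  by rewrite linextU scale1r FP.
by rewrite linearP supportedP.
Qed.

Lemma supportedM P P' P'' f g :
  (forall e e', P e -> P' e' -> P'' (e + e')) ->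
  f \in supported P -> g \in supported P' -> f * g \in supported P''.
Proof.
move=> PP fP gP; rewrite -[f * g]/(qmul f g) unlock.
apply: supported_linext fP => e Pe; apply: supported_linext gP => e' Pe'.
by rewrite supported_mono PP.
Qed.

(** A monomial with exponent 0 at i is killed, so the condition is only needed where the exponent
    can be lowered; this keeps natural exponents natural. *)
Lemma supported_pder P P' i f :
  (forall e, P e -> e@_i != 0 -> P' (e - delta i)) ->
  f \in supported P -> pder i f \in supported P'.
Proof.
move=> PP; apply: supported_linext => e Pe; have [->|ei] := eqVneq e@_i 0.
  by rewrite scale0r supported0.
by rewrite supportedZ // supported_mono PP.
Qed.
End SupportClosure.

Lemma calR_expoP e : reflect (e@_0 = 0 /\ forall i, e@_i \is a Num.nat) (e \in calR_expo).
Proof.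
apply: (iffP allP) => [eR|[e0 en] i ie].
  split=> [|i]; first by have [/eR|/mcoeff_outdom//] := boolP (0%N \in msupp e).
  by have [/eR/andP[]|/mcoeff_outdom->] := boolP (i \in msupp e); rewrite ?rpred0.
by rewrite en andbT lt0n; apply: contraL ie => /eqP->; rewrite -mcoeff_eq0 e0.
Qed.

Lemma Lambda_expoP e :
  reflect [/\ e@_0 = 0, e@_1 = 0 & forall i, e@_i \is a Num.nat] (e \in Lambda_expo).
Proof.
apply: (iffP allP) => [eR|[e0 e1 en] i ie].
  split=> [||i].
  - by have [/eR|/mcoeff_outdom//] := boolP (0%N \in msupp e).
  - by have [/eR|/mcoeff_outdom//] := boolP (1%N \in msupp e).
  by have [/eR/andP[]|/mcoeff_outdom->] := boolP (i \in msupp e); rewrite ?rpred0.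
rewrite en andbT; case: i ie => [|[|i]] //.
  by rewrite -mcoeff_neq0 e0 eqxx.
by rewrite -mcoeff_neq0 e1 eqxx.
Qed.

Lemma mcoeff_delta i j : (delta i)@_j = (i == j)%:R.
Proof. exact: mcoeffU. Qed.

Lemma calRE : calR = supported calR_expo. Proof. by []. Qed.
Lemma tRE : tR = supported tR_expo. Proof. by []. Qed.
Lemma homogE w : homog w = supported (fun e => weight e == w). Proof. by []. Qed.

Lemma calR_M f g : f \in calR -> g \in calR -> f * g \in calR.
Proof.
apply: supportedM => e e' /calR_expoP[e0 en] /calR_expoP[e'0 e'n].
apply/calR_expoP; split=> [|i]; first by rewrite mcoeffD e0 e'0 addr0.
by rewrite mcoeffD rpredD.
Qed.

Lemma natr_pred (x : rat) : x \is a Num.nat -> x != 0 -> x - 1 \is a Num.nat.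
Proof. by move=> /natrP[[|k] ->] // _; rewrite -natr1 addrK natr_nat. Qed.

Lemma calR_pder i f : f \in calR -> pder i f \in calR.
Proof.
apply: supported_pder => e /calR_expoP[e0 en] ei; apply/calR_expoP.
have i0 : i != 0%N by apply: contra ei => /eqP->; rewrite e0.
split=> [|j]; rewrite mcoeffB mcoeff_delta; first by rewrite (negPf i0) subr0.
by case: (eqVneq i j) ei => [->|_ _]; rewrite ?subr0 //; apply: natr_pred.
Qed.

Lemma calR_qvar m : qvar m \in calR.
Proof.
case: m => [|m]; rewrite calRE supported_mono; apply/calR_expoP.
  by rewrite mcoeff0; split=> // i; rewrite mcoeff0 rpred0.
by rewrite mcoeff_delta; split=> // i; rewrite mcoeff_delta.
Qed.

Lemma tR_qvar m : qvar m \in tR.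
Proof. exact/calR_tR/calR_qvar. Qed.

Section DifferentialClosure.
Variable P : {pred expo}.
Notation S := (supported P).
Hypotheses (SM : forall f g, f \in S -> g \in S -> f * g \in S).
Hypotheses (Spder : forall i f, f \in S -> pder i f \in S).
Hypotheses (Sqvar : forall m, qvar m \in S).

Lemma scrD_closed m f : f \in S -> scrD m f \in S.
Proof.
move=> Sf; apply: supported_sum => t _; apply/supportedZ/SM => //.
by elim: (map val t) => //= i s; apply: Spder.
Qed.

Lemma bpartial_closed f : f \in S -> bpartial f \in S.
Proof. by rewrite -scrD1; apply: scrD_closed. Qed.

Lemma iter_bpartial_closed i f : f \in S -> iter i bpartial f \in S.
Proof. by move=> Sf; elim: i => //= i; apply: bpartial_closed. Qed.

Lemma Delta__closed m f : f \in S -> Delta_ m f \in S.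
Proof.
by move=> Sf; apply: supported_sum => i _; apply/supportedZ/scrD_closed/iter_bpartial_closed.
Qed.
End DifferentialClosure.

Lemma calR_bpartial f : f \in calR -> bpartial f \in calR.
Proof. exact: (bpartial_closed calR_M calR_pder calR_qvar). Qed.

Lemma calR_Delta f : f \in calR -> Delta f \in calR.
Proof.
move=> fR; rewrite Delta_2; apply: supportedZ.
exact: (Delta__closed calR_M calR_pder calR_qvar).
Qed.

Lemma tR_Delta_ m f : f \in tR -> Delta_ m f \in tR.
Proof. exact: (Delta__closed tRM tR_pder tR_qvar). Qed.

Lemma tR_bpartial f : f \in tR -> bpartial f \in tR.
Proof. exact: (bpartial_closed tRM tR_pder tR_qvar). Qed.

Lemma weight_linear : scalar weight.
Proof.
move=> c e e'; have E f : weight f = linext (fun i => i%:R : rat^o) f.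
  by apply: eq_bigr => i _; rewrite mulrC.
by rewrite !E linearP.
Qed.
HB.instance Definition _ :=
  GRing.isLinear.Build rat expo rat *%R weight weight_linear.

Lemma weight_delta i : weight (delta i) = i%:R.
Proof. by rewrite /weight msuppU oner_eq0 big_seq_fset1 mcoeffUU mulr1. Qed.

Lemma homogM v w f g : f \in homog v -> g \in homog w -> f * g \in homog (v + w).
Proof.
by apply: supportedM => e e' /eqP ev /eqP e'w; rewrite raddfD /= ev e'w.
Qed.

Lemma homog_pder w i f : f \in homog w -> pder i f \in homog (w - i%:R).
Proof.
by apply: supported_pder => e /eqP ew _; rewrite raddfB /= ew weight_delta.
Qed.

Lemma homog_qvar m : qvar m \in homog m%:R.
Proof.
case: m => [|m]; rewrite homogE supported_mono; first by rewrite raddf0.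
by rewrite weight_delta.
Qed.

(** The derivatives indexed by s remove weight [sumn s + size s], and Q_(sumn s) restores [sumn s],
    for a net loss of m. *)
Lemma homog_scrD w m f : f \in homog w -> scrD m f \in homog (w - m%:R).
Proof.
move=> fw; apply: supported_sum => t _; apply: supportedZ; rewrite -homogE.
have E s : qvar (sumn s) * pders s f \in homog (w - (size s)%:R).
  have -> : w - (size s)%:R = (sumn s)%:R + (w - (sumn s)%:R - (size s)%:R) by ring.
  apply: homogM; first exact: homog_qvar.
  elim: s => [|i s IH] /=; first by rewrite !subr0.
  have -> : w - (i + sumn s)%:R - (size s).+1%:R
     = w - (sumn s)%:R - (size s)%:R - i.+1%:R by rewrite natrD -!natr1; ring.
  exact: homog_pder.
by have := E (map val t); rewrite size_map size_tuple.
Qed.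

Lemma homog_Delta_ w m f : f \in homog w -> Delta_ m f \in homog (w - m%:R).
Proof.
move=> fw; apply: supported_sum => i _; apply: supportedZ; rewrite -homogE.
have -> : w - m%:R = w - i%:R - (m - i)%:R.
  by rewrite natrB ?[(i <= m)%N]ltnS -1?ltnS ?ltn_ord //; ring.
apply: homog_scrD; elim: (i : nat) => [|j IH]; first by rewrite subr0.
by rewrite iterS -scrD1 -natr1 opprD addrA; apply: homog_scrD.
Qed.

(** * Multiplication by powers of Q_2 *)

Definition qp (s : rat) : qalg := mono (s *: delta 2).

Lemma qpD s t : qp (s + t) = qp s * qp t.
Proof. by rewrite /qp scalerDl monoM. Qed.

Lemma qp0 : qp 0 = 1.
Proof. by rewrite /qp scale0r. Qed.

Lemma qp1 : qp 1 = qvar 2.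
Proof. by rewrite /qp scale1r. Qed.

Lemma qpS r : qp r = qp (r - 1) * qvar 2.
Proof. by rewrite -qp1 -qpD subrK. Qed.

Lemma qpK s f : qp s * (qp (- s) * f) = f.
Proof. by rewrite mulrA -qpD addrN qp0 mul1r. Qed.

Lemma qpKV s f : qp (- s) * (qp s * f) = f.
Proof. by rewrite mulrA -qpD addNr qp0 mul1r. Qed.

Lemma pder_qp i r : pder i (qp r) = (i == 2)%:R * (r *: qp (r - 1)).
Proof.
rewrite /qp pder_mono mcoeffZ mcoeff_delta eq_sym.
case: eqP => [->|_]; last by rewrite mulr0 scale0r mul0r.
by rewrite mulr1 mul1r scalerBl scale1r.
Qed.

Lemma dQ_qp i r : dQ i (qp r) = (i == 1)%:R * (r *: qp (r - 1)).
Proof. exact: pder_qp. Qed.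

Lemma weight_qp r : weight (r *: delta 2) = r * 2.
Proof. by rewrite linearZ /= weight_delta. Qed.

Lemma homog_qp r : qp r \in homog (r * 2).
Proof. by rewrite homogE supported_mono weight_qp. Qed.

Lemma tR_qp r : r *+ 2 \is a Num.int -> qp r \in tR.
Proof.
move=> r2; rewrite tRE supported_mono; apply/tR_expoP.
rewrite !mcoeffZ !mcoeff_delta mulr0 mulr1; split=> // i _ i2.
by rewrite mcoeffZ mcoeff_delta eq_sym (negPf i2) mulr0 rpred0.
Qed.

Lemma mem_nvars f e i : e \in msupp f -> i \in msupp e -> (i <= nvars f)%N.
Proof.
move=> ef ie; rewrite /nvars (big_rem e) //= leq_max (big_rem i) //=.
by rewrite leq_max leqnn.
Qed.

Lemma weightE e N : (forall i, i \in msupp e -> i <= N)%N ->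
  weight e = \sum_(l < N) l.+1%:R * e@_l.+1.
Proof.
move=> eN; pose F i : rat := i%:R * e@_i.
transitivity (\sum_(i <- iota 0 N.+1 | i \in msupp e) F i).
  rewrite -big_filter; apply: perm_big; apply: uniq_perm.
  - exact: fset_uniq.
  - by rewrite filter_uniq ?iota_uniq.
  move=> i; rewrite mem_filter mem_iota add0n ltnS /=.
  by case: (boolP (i \in msupp e)) => // /eN->.
rewrite big_mkcond (eq_bigr F); last first.
  by move=> i _; case: ifPn => // /mcoeff_outdom; rewrite /F => ->; rewrite mulr0.
rewrite -[iota 0 N.+1]/(index_iota 0 N.+1) big_mkord big_ord_recl.
have F0 : F 0%N = 0 by rewrite /F mul0r.
by rewrite /= F0 add0r; apply: eq_bigr.
Qed.

Lemma qvar_pder i (f : qalg) :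
  qvar i.+1 * pder i.+1 f = \sum_(e <- msupp f) (f@_e * e@_i.+1) *: mono e.
Proof.
rewrite /pder /linext mulr_sumr; apply: eq_bigr => e _.
by rewrite scalerA -scalerAr monoM addrC subrK.
Qed.

Lemma Euler w f N : f \in homog w -> (nvars f <= N)%N ->
  \sum_(l < N) l.+1%:R * (qvar l.+1 * dQ l f) = w *: f.
Proof.
move=> /allP fw fN; under eq_bigr => l _ do rewrite qvar_pder mulr_sumr.
rewrite exchange_big /= [in RHS](qalgE f) scaler_sumr !big_seq.
apply: eq_bigr => e ef; have /eqP <- := fw e ef.
rewrite (@weightE e N) => [|i ie]; last exact: leq_trans (mem_nvars ef ie) fN.
rewrite scalerA mulr_suml scaler_suml; apply: eq_bigr => l _.
by rewrite mulr_natl -scaler_nat scalerA mulrAC mulrA.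
Qed.

Lemma Delta_laplace f N : (nvars f <= N)%N -> (nvars (bpartial f) <= N)%N ->
  Delta f = laplace dQ qvar N f.
Proof.
move=> fN bN; rewrite /Delta /laplace (calD_d2der fN) (bpartial_bder bN).
by rewrite (bpartial_bder fN).
Qed.

Lemma Delta_qp r f w : f \in homog w ->
  Delta (qp r * f) = qp r * Delta f + (r * (w + r - 3 / 2)) *: (qp (r - 1) * f)
    - qvar 1 * (r *: (qp (r - 1) * bpartial f)
                + (r * (r - 1) / 2) *: (qp (r - 2) * (qvar 1 * f))).
Proof.
move=> fw; pose N := (nvars (qp r * f)%R + nvars f + nvars (bpartial f)
  + nvars (bpartial (qp r * f)%R) + 2)%N.
have fN : (nvars f <= N)%N by rewrite /N; lia.
have gN : (nvars (qp r * f)%R <= N)%N by rewrite /N; lia.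
have bfN : (nvars (bpartial f) <= N)%N by rewrite /N; lia.
have bgN : (nvars (bpartial (qp r * f)%R) <= N)%N by rewrite /N; lia.
have N1 : (1 < N)%N by rewrite /N addn2.
rewrite (Delta_laplace gN bgN) (Delta_laplace fN bfN) (bpartial_bder fN).
exact: (laplace_homog_y dQM dQ_qvar qpS dQ_qp r N1 (erefl _) (Euler fw fN)).
Qed.

Lemma bpartial_qpM r f :
  bpartial (qp r * f) = qp (r - 1) * (qvar 1 * (r *: f) + qvar 2 * bpartial f).
Proof.
pose N := (nvars (qp r * f)%R + nvars f + 2)%N.
have fN : (nvars f <= N)%N by rewrite /N; lia.
have gN : (nvars (qp r * f)%R <= N)%N by rewrite /N; lia.
have N1 : (1 < N)%N by rewrite /N addn2.
rewrite (bpartial_bder gN) (bpartial_bder fN).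
exact: (bder_yM dQM qpS dQ_qp).
Qed.

Lemma scrD_qpM m r f : f \in calR -> exists2 h, h \in calR &
  scrD m (qp r * f) = qp (r - m%:R)
    * (((\prod_(j < m) (r - j%:R)) * m`!%:R) *: (qvar m * f) + qvar 2 * h).
Proof.
move=> fR; pose N := (nvars (qp r * f)%R + 2)%N.
have gN : (nvars (qp r * f)%R <= N)%N by rewrite /N; lia.
have N1 : (1 < N)%N by rewrite /N addn2.
rewrite (scrD_symb m gN).
apply: (lfun_iter_lead dQM (S := fun f => f \in calR)) N1 fR => //.
- exact: supported0.
- exact: supportedD.
- exact: calR_M.
- by move=> c; apply/supportedZ/(calR_qvar 0).
- by move=> i g; apply: calR_pder.
- exact: calR_qvar.
- exact: qpS.
exact: dQ_qp.
Qed.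

(** * Leading terms modulo Q_1 and Q_2 *)

Section Ideal2.
Variables (A : comAlgType rat) (S : A -> Prop) (a b : A).
Hypotheses (S0 : S 0) (SD : forall f g, S f -> S g -> S (f + g)).
Hypotheses (SM : forall f g, S f -> S g -> S (f * g)).
Hypotheses (SZ : forall (c : rat) f, S f -> S (c *: f)).

(** The cofactors are confined to the subring [S]: in [qalg] both Q_1 and Q_2 are units, so an ideal
    of the whole algebra would carry no information. *)
Definition ideal2 x : Prop := exists g h, [/\ S g, S h & x = a * g + b * h].

Lemma ideal2_0 : ideal2 0.
Proof. by exists 0, 0; rewrite !mulr0 addr0. Qed.

Lemma ideal2D x y : ideal2 x -> ideal2 y -> ideal2 (x + y).
Proof.
move=> [g [h [gR hR ->]]] [g' [h' [g'R h'R ->]]].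
by exists (g + g'), (h + h'); split; rewrite ?mulrDr 1?addrACA //; apply: SD.
Qed.

Lemma ideal2Z c x : ideal2 x -> ideal2 (c *: x).
Proof.
move=> [g [h [gR hR ->]]]; exists (c *: g), (c *: h).
by split; rewrite ?scalerDr ?scalerAr //; apply: SZ.
Qed.

Lemma ideal2M f x : S f -> ideal2 x -> ideal2 (f * x).
Proof.
move=> fR [g [h [gR hR ->]]]; exists (f * g), (f * h).
by split; rewrite ?mulrDr ?(mulrCA f) //; apply: SM.
Qed.

Lemma ideal2_l g : S g -> ideal2 (a * g).
Proof. by exists g, 0; rewrite mulr0 addr0. Qed.

Lemma ideal2_r h : S h -> ideal2 (b * h).
Proof. by exists 0, h; rewrite mulr0 add0r. Qed.

Lemma ideal2_sub x : S a -> S b -> ideal2 x -> S x.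
Proof. by move=> Sa Sb [g [h [gR hR ->]]]; apply: SD; apply: SM. Qed.
End Ideal2.

Definition ideal12 := ideal2 (fun f => f \in calR) (qvar 1) (qvar 2).

Lemma calR0 : 0 \in calR. Proof. exact: supported0. Qed.

Lemma calR_D f g : f \in calR -> g \in calR -> f + g \in calR.
Proof. exact: supportedD. Qed.

Lemma calR_Z c f : f \in calR -> c *: f \in calR.
Proof. exact: supportedZ. Qed.

Lemma ideal12_0 : ideal12 0. Proof. exact: ideal2_0 calR0. Qed.

Lemma ideal12D x y : ideal12 x -> ideal12 y -> ideal12 (x + y).
Proof. exact: (ideal2D calR_D). Qed.

Lemma ideal12Z c x : ideal12 x -> ideal12 (c *: x).
Proof. exact: (ideal2Z calR_Z). Qed.

Lemma ideal12M f x : f \in calR -> ideal12 x -> ideal12 (f * x).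
Proof. exact: (ideal2M calR_M). Qed.

Lemma ideal12_q1 g : g \in calR -> ideal12 (qvar 1 * g).
Proof. exact: (ideal2_l _ _ calR0). Qed.

Lemma ideal12_q2 h : h \in calR -> ideal12 (qvar 2 * h).
Proof. exact: (ideal2_r _ _ calR0). Qed.

Lemma ideal12_calR x : ideal12 x -> x \in calR.
Proof. exact: (ideal2_sub calR_D calR_M (calR_qvar 1) (calR_qvar 2)). Qed.

(** A single bpartial already moves the cofactor of the power of Q_2 into the ideal (Q_1, Q_2).
    Hence only the term i = 0 of Delta_m contributes to the leading term. *)
Lemma iter_bpartial_qpM i r f : f \in calR -> exists2 g,
  g \in calR /\ ((0 < i)%N -> ideal12 g) & iter i bpartial (qp r * f) = qp (r - i%:R) * g.
Proof.
move=> fR; elim: i => [|i [g [gR _] E]]; first by exists f; rewrite ?subr0.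
have gI : ideal12 (qvar 1 * ((r - i%:R) *: g) + qvar 2 * bpartial g).
  apply: ideal12D; first exact/ideal12_q1/supportedZ.
  exact/ideal12_q2/calR_bpartial.
exists (qvar 1 * ((r - i%:R) *: g) + qvar 2 * bpartial g).
  by split=> //; apply: ideal12_calR.
have -> : r - i.+1%:R = r - i%:R - 1 by rewrite -natr1 opprD addrA.
by rewrite iterS E bpartial_qpM.
Qed.

Lemma Delta__qpM m r f : f \in calR -> exists2 x, ideal12 x &
  Delta_ m (qp r * f) = qp (r - m%:R)
    * (((\prod_(j < m) (r - j%:R)) * m`!%:R) *: (qvar m * f) + x).
Proof.
move=> fR; rewrite /Delta_ big_ord_recl /= subn0.
have [h hR E] := scrD_qpM m r fR.
have [x xI Ex] : exists2 x, ideal12 x & \sum_(i < m)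
    ((-1) ^+ lift ord0 i * 'C(m, lift ord0 i)%:R)
      *: scrD (m - lift ord0 i) (iter (lift ord0 i) bpartial (qp r * f))
    = qp (r - m%:R) * x.
  apply: (big_ind (fun y => exists2 x, ideal12 x & y = qp (r - m%:R) * x)).
  - by exists 0; [exact: ideal12_0|rewrite mulr0].
  - move=> _ _ [x xI ->] [y yI ->]; exists (x + y); first exact: ideal12D.
    by rewrite mulrDr.
  move=> i _; have [g [gR gI] Eg] := iter_bpartial_qpM (lift ord0 i) r fR.
  have [k kR Ek] := scrD_qpM (m - lift ord0 i) (r - (lift ord0 i)%:R) gR.
  have le_im : (lift ord0 i <= m)%N by rewrite lift0 ltn_ord.
  have <- : r - (lift ord0 i)%:R - (m - lift ord0 i)%:R = r - m%:R.
    by rewrite -addrA -opprD -natrD subnKC.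
  rewrite Eg Ek scalerAr; set x := (_ *: (_ + _)); exists x => //.
  apply/ideal12Z/ideal12D; last exact: ideal12_q2.
  by apply/ideal12Z/ideal12M; [exact: calR_qvar|apply: gI].
exists (qvar 2 * h + x); first by apply: ideal12D => //; apply: ideal12_q2.
by rewrite E Ex expr0 bin0 mulr1 scale1r -mulrDr addrA.
Qed.

Definition qprod (la : seq nat) : qalg := \prod_(i <- la) qvar i.

(** These are the factors that Delta_m produces from Q_2^(3/2 - n); being half-integers, they leave
    the leading coefficient nonzero. *)
Lemma half_neq n j : (3 / 2 - n%:R - j%:R : rat) != 0.
Proof.
apply/eqP => E; have : (3%:R : rat) = ((n + j) * 2)%:R by rewrite natrM natrD; lra.
by move/eqP; rewrite eqr_nat; lia.
Qed.

Lemma foldr_Delta_lead la : exists c x, [/\ c != 0, ideal12 x &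
  foldr Delta_ (qp (3 / 2)) la = qp (3 / 2 - (sumn la)%:R) * (c *: qprod la + x)].
Proof.
elim: la => [|m la [c [x [c0 xI E]]]].
  exists 1, 0; rewrite oner_eq0 subr0 addr0 scale1r /qprod big_nil mulr1; split=> //.
  exact: ideal12_0.
have fR : c *: qprod la + x \in calR.
  apply: supportedD; last exact: ideal12_calR.
  apply: supportedZ; apply: (big_ind (fun f => f \in calR)) => [||i _].
  - exact: calR_qvar 0.
  - exact: calR_M.
  exact: calR_qvar.
rewrite /= E; have [y yI ->] := Delta__qpM m (3 / 2 - (sumn la)%:R) fR.
set c' := (\prod_(j < m) _ * _).
have c'0 : c' != 0.
  rewrite mulf_neq0 ?pnatr_eq0 -?lt0n ?fact_gt0 //.
  by apply/prodf_neq0 => j _; apply: half_neq.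
exists (c' * c), (c' *: (qvar m * x) + y); split; first by rewrite mulf_neq0.
  by apply: ideal12D => //; apply/ideal12Z/ideal12M => //; apply: calR_qvar.
have -> : 3 / 2 - (m + sumn la)%:R = 3 / 2 - (sumn la)%:R - m%:R :> rat.
  by rewrite addnC natrD opprD addrA.
have lead (A : comAlgType rat) (a p z t : A) :
    c' *: (a * (c *: p + z)) + t = (c' * c) *: (a * p) + (c' *: (a * z) + t).
  by rewrite mulrDr -scalerAr scalerDr scalerA addrA.
by rewrite /qprod big_cons lead.
Qed.

(** * Harmonic elements *)

Lemma Delta1 : Delta 1 = 0.
Proof.
have d1 i : pder i.+1 1 = 0 := der1 dQM i.
have b1 : bpartial 1 = 0 by rewrite /bpartial big1 // => i _; rewrite d1 mulr0.
rewrite /Delta b1 linear0 subr0 /calD big1 ?scaler0 // => k _.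
by rewrite big1 // => l _; rewrite d1 linear0 mulr0 scaler0.
Qed.

Lemma foldr_Delta_q1 la f : foldr Delta_ (qvar 1 * f) la = qvar 1 * foldr Delta_ f la.
Proof. by elim: la => //= m la ->; rewrite Delta__q1. Qed.

Lemma Delta_foldr la f : Delta (foldr Delta_ f la) = foldr Delta_ (Delta f) la.
Proof. by elim: la => //= m la IH; rewrite Delta_Delta_ IH. Qed.

Lemma tR_foldr la f : f \in tR -> foldr Delta_ f la \in tR.
Proof. by move=> fR; elim: la => //= m la; apply: tR_Delta_. Qed.

Lemma homog_foldr w la f :
  f \in homog w -> foldr Delta_ f la \in homog (w - (sumn la)%:R).
Proof.
move=> fw; elim: la => [|m la IH] /=; first by rewrite subr0.
have -> : w - (m + sumn la)%:R = w - (sumn la)%:R - m%:R.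
  by rewrite addnC natrD opprD addrA.
exact: homog_Delta_.
Qed.

Lemma tR_D f g : f \in tR -> g \in tR -> f + g \in tR.
Proof. exact: supportedD. Qed.

Lemma half_int n : (3 / 2 - n%:R : rat) *+ 2 \is a Num.int.
Proof.
have -> : (3 / 2 - n%:R : rat) *+ 2 = 3%:R - (n * 2)%:R by rewrite natrM; lra.
by rewrite rpredB ?intr_nat ?natr_nat.
Qed.

Lemma pr_q1 f : f \in tR -> pr (qvar 1 * f) = 0.
Proof. by move=> fR; rewrite prM ?tR_qvar // pr_qvar mul0r. Qed.

Definition correction r f : qalg := r *: (qp (r - 1) * bpartial f)
  + (r * (r - 1) / 2) *: (qp (r - 2) * (qvar 1 * f)).

Lemma tR_correction r f : r *+ 2 \is a Num.int -> f \in tR -> correction r f \in tR.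
Proof.
move=> r2 fR; apply: tR_D; apply: tRZ; apply: tRM.
- by apply: tR_qp; rewrite mulrnBl rpredB // intr_nat ?natr_nat.
- exact: tR_bpartial.
- by apply: tR_qp; rewrite mulrnBl rpredB // -mulrnA intr_nat ?natr_nat.
by apply: tRM => //; apply: tR_qvar.
Qed.

(* The factor [w + r - 3/2] of [Delta_qp] vanishes for [r = 3/2 - n], [w = n]:
   this is why the Kelvin transform preserves harmonicity. *)
Lemma pr_Delta_foldr n G la : sumn la = n -> G \in tR -> G \in homog n%:R ->
  foldr Delta_ (qp (3 / 2)) la = qp (3 / 2 - n%:R) * G -> pr (Delta G) = 0.
Proof.
move=> sn GR Gn E; set s := 3 / 2 - n%:R in E.
(* For r = 3/2 and w = 0 the middle term of [Delta_qp] vanishes, so Delta K(1) is a multiple of Q_1;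
   the operators Delta_m carry this factor along. *)
have D0 : Delta (qp (3 / 2)) = qvar 1 * - correction (3 / 2) 1.
  have h1 : (1 : qalg) \in homog 0 := homog_qvar 0.
  have c0 : 3 / 2 * (0 + 3 / 2 - 3 / 2) = 0 :> rat by lra.
  have lem (A : comAlgType rat) (a b c e : A) : a * 0 + (0 : rat) *: e - b * c = b * - c.
    by rewrite mulr0 scale0r !add0r mulrN.
  have := Delta_qp (3 / 2) h1; rewrite -/(correction (3 / 2) 1) Delta1 c0 lem.
  by rewrite (mulr1 (qp _)).
have c1 : - correction (3 / 2) 1 \in tR.
  apply: supportedN; apply: tR_correction (tR_qvar 0).
  by have := half_int 0; rewrite subr0.
have c2 : correction s G \in tR by apply: tR_correction => //; apply: half_int.
have F1 := Delta_foldr la (qp (3 / 2)).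
rewrite D0 foldr_Delta_q1 E (Delta_qp s Gn) -/(correction s G) in F1.
set H := foldr Delta_ _ la in F1.
have HR : H \in tR by apply: tR_foldr.
have s0 : s * (n%:R + s - 3 / 2) = 0 by rewrite /s; lra.
have F2 : qp s * Delta G = qvar 1 * (H + correction s G).
  have lem (A : comAlgType rat) (a b c e h : A) :
    a + (0 : rat) *: e - b * c = b * h -> a = b * (h + c).
    by rewrite scale0r addr0 mulrDr => <-; rewrite subrK.
  by move: F1; rewrite s0; apply: lem.
have -> : Delta G = qvar 1 * (qp (- s) * (H + correction s G)).
  apply: etrans (esym (qpKV s (Delta G))) _.
  exact: etrans (congr1 (fun x => qp (- s) * x) F2) (mulrCA (qp (- s)) (qvar 1) _).
apply: pr_q1; apply: tRM; last exact: tR_D.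
by apply: tR_qp; rewrite mulNrn rpredN; apply: half_int.
Qed.

Lemma pr_Lambda f : f \in calR -> pr f \in Lambda.
Proof.
apply: supported_linext => e /calR_expoP[e0 en]; case: eqP => [e1|_]; last exact: supported0.
by rewrite supported_mono; apply/Lambda_expoP.
Qed.

Lemma pr_id f : f \in Lambda -> pr f = f.
Proof.
move: f; apply: supported_ind => [|e /Lambda_expoP[_ e1 _]|c f g Ef Eg].
- exact: linear0.
- by rewrite pr_mono e1 eqxx.
by rewrite linearP /= Ef Eg.
Qed.

Lemma pr_homog w f : f \in homog w -> pr f \in homog w.
Proof.
apply: supported_linext => e ew; case: eqP => _; last exact: supported0.
by rewrite supported_mono.
Qed.

Lemma pr_qp r : pr (qp r) = qp r.
Proof. by rewrite pr_mono mcoeffZ mcoeff_delta mulr0 eqxx. Qed.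

Lemma pr_complement f : f \in calR -> exists2 g, g \in calR & f = pr f + qvar 1 * g.
Proof.
move: f; apply: supported_ind => [|e eR|c f f' [g gR Ef] [g' g'R Ef']].
- by exists 0; [exact: calR0|rewrite linear0 mulr0 addr0].
- rewrite pr_mono; case: eqP => [_|/eqP e1].
    by exists 0; [exact: calR0|rewrite mulr0 addr0].
  exists (mono (e - delta 1)); last by rewrite add0r monoM addrC subrK.
  rewrite calRE supported_mono; case/calR_expoP: eR => e0 en; apply/calR_expoP.
  split=> [|i]; rewrite mcoeffB mcoeff_delta; first by rewrite subr0.
  by case: (eqVneq 1%N i) => [<-|_]; rewrite ?subr0 //; apply: natr_pred.
exists (c *: g + g'); first exact: supportedP.
have lem (A : comAlgType rat) (a p q p' q' : A) :
    c *: (p + a * q) + (p' + a * q') = c *: p + p' + a * (c *: q + q').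
  by rewrite mulrDr scalerDr addrACA scalerAr.
by rewrite linearP /= -lem -Ef -Ef'.
Qed.

(** With divisibility by Q_1 rewritten as vanishing under [pr], harmonicity can be tested inside
    [tR], where negative powers of Q_2 are available. *)
Lemma harmonicP n f :
  harmonic n f <-> [/\ f \in Lambda, f \in homog n%:R & pr (Delta f) = 0].
Proof.
split=> -[fL fn]; last first.
  move=> D0; split=> //; have [g gR E] := pr_complement (calR_Delta (Lambda_calR fL)).
  by exists g => //; rewrite E D0 add0r.
by move=> [g gR E]; split=> //; rewrite E; apply/pr_q1/calR_tR.
Qed.

Definition expo_of (la : seq nat) : expo := \sum_(i <- la) delta i.

Lemma mcoeff_expo_of la j : (expo_of la)@_j = (count_mem j la)%:R.
Proof.
rewrite /expo_of; elim: la => [|i la IH]; first by rewrite big_nil mcoeff0.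
by rewrite big_cons mcoeffD IH mcoeff_delta /= natrD.
Qed.

Lemma qprod_mono la : all (leq 1) la -> qprod la = mono (expo_of la).
Proof.
elim: la => [|i la IH]; first by rewrite /qprod /expo_of !big_nil.
case/andP=> i0 /IH E; rewrite /qprod /expo_of !big_cons -/(qprod la) E.
by case: i i0 => [|i] i0; [discriminate i0|apply: monoM].
Qed.

Definition basis_elt la : qalg := pr (Kelvin (Delta_part la (Kelvin 1))).

Lemma multinomial_neq0 s : multinomial s != 0.
Proof.
have fN i : (i`!%:R : rat) != 0 by rewrite pnatr_eq0 -lt0n fact_gt0.
by rewrite mulf_neq0 ?invr_eq0 // prodf_seq_neq0; apply/allP => i _; apply: fN.
Qed.

Lemma qalg_one_homog : (1 : qalg) \in homog 0.
Proof. exact: homog_qvar 0. Qed.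

Lemma basis_eltE la : exists2 G, [/\ G \in calR, G \in homog (sumn la)%:R,
    pr (Delta G) = 0 & exists c x, [/\ c != 0, ideal12 x & G = c *: qprod la + x]]
  & basis_elt la = multinomial la *: pr G.
Proof.
have [c [x [c0 xI E]]] := foldr_Delta_lead la.
set s := 3 / 2 - _ in E; set G := c *: qprod la + x in E.
have GR : G \in calR.
  apply: calR_D (ideal12_calR xI); apply: calR_Z.
  by apply: (big_ind (fun f => f \in calR)) => [||i _];
    [exact: (calR_qvar 0)|exact: calR_M|exact: calR_qvar].
have Fh := homog_foldr la (homog_qp (3 / 2)).
have Gn : G \in homog (sumn la)%:R.
  have EG : qp (- s) * foldr Delta_ (qp (3 / 2)) la = G.
    exact: etrans (congr1 (fun f => qp (- s) * f) E) (qpKV s G).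
  have Es : - s * 2 + (3 / 2 * 2 - (sumn la)%:R) = (sumn la)%:R by rewrite /s; lra.
  by have := homogM (homog_qp (- s)) Fh; rewrite EG Es.
exists G.
  split=> //; last by exists c, x.
  exact: (pr_Delta_foldr erefl (calR_tR GR) Gn E).
have K1 : Kelvin 1 = qp (3 / 2).
  by rewrite (KelvinE qalg_one_homog) subr0; apply: mulr1.
rewrite /basis_elt K1 /Delta_part (KelvinE (supportedZ _ Fh)) E.
(* The argument of the outer Kelvin transform has weight 3 - |la|, so it is multiplied by Q_2^(|la|
   - 3/2), which cancels the power in front of G. *)
have -> : 3 / 2 - (3 / 2 * 2 - (sumn la)%:R) = - s by rewrite /s; lra.
by rewrite -/(qp _) -scalerAr qpKV linearZ.
Qed.

Lemma basis_elt_harmonic la : harmonic (sumn la) (basis_elt la).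
Proof.
have [G [GR Gn DG _] ->] := basis_eltE la; apply/harmonicP; split.
- exact/supportedZ/pr_Lambda.
- exact/supportedZ/pr_homog.
(* G and [pr G] differ by a multiple of Q_1, and Delta commutes with Q_1, so vanishing of pr Delta
   passes from G to [pr G]. *)
have [g gR EG] := pr_complement GR.
have PZ c u : pr (Delta (c *: u)) = c *: pr (Delta u) by rewrite [Delta _]linearZ linearZ.
rewrite PZ; suff -> : pr (Delta (pr G)) = 0 by rewrite scaler0.
have PD u v : pr (Delta (u + v)) = pr (Delta u) + pr (Delta v) by rewrite [Delta _]linearD linearD.
by rewrite -DG [in RHS]EG PD Delta_q1 (pr_q1 (calR_tR (calR_Delta gR))) addr0.
Qed.

Lemma mcoeff_q2M g e : g \in Lambda -> e@_2 = 0 -> (qvar 2 * g)@_e = 0.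
Proof.
move=> gL e2; apply: mcoeff_outdom; apply/negP => ef.
have : qvar 2 * g \in supported (fun e => e@_2 != 0).
  apply: (@supportedM (pred1 (delta 2)) Lambda_expo) gL; last by rewrite supported_mono /= eqxx.
  move=> _ e' /eqP-> /Lambda_expoP[_ _ en].
  by rewrite mcoeffD mcoeff_delta gt_eqF // ltr_wpDr ?natr_ge0.
by move=> /allP/(_ e ef); rewrite e2 eqxx.
Qed.

(** On monomials free of Q_2 the proposed basis is diagonal: [pr] removes Q_1 and the remainder is
    divisible by Q_2. This gives both independence and the coefficients of an expansion. *)
Lemma basis_elt_coef la : all (leq 3) la -> exists2 c, c != 0 &
  forall e, e@_2 = 0 -> (basis_elt la)@_e = c * (expo_of la == e)%:R.
Proof.
move=> la3; have [G [GR Gn DG [c [x [c0 [g [h [gR hR Ex]]] EG]]]] ->] := basis_eltE la.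
have la1 : all (leq 1) la by apply: sub_all la3 => i; apply: leq_trans.
have la1' : count_mem 1%N la = 0%N.
  by apply/count_memPn; apply/negP => /(allP la3).
have prG : pr G = c *: mono (expo_of la) + qvar 2 * pr h.
  have prl (f1 f2 f3 : qalg) : pr (c *: f1 + (f2 + f3)) = c *: pr f1 + (pr f2 + pr f3).
    by rewrite linearP /= linearD.
  rewrite EG Ex prl (pr_q1 (calR_tR gR)) add0r.
  rewrite (prM (tR_qvar 2) (calR_tR hR)) pr_qvar /= (qprod_mono la1) pr_mono.
  by rewrite mcoeff_expo_of la1' eqxx.
exists (multinomial la * c); first by rewrite mulf_neq0 ?multinomial_neq0.
move=> e e2; rewrite prG mcoeffZ mcoeffD (mcoeff_q2M (pr_Lambda hR) e2) addr0.
by rewrite mcoeffZ mulrA mcoeffU.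
Qed.

Lemma Lambda_homog_neg w f : w < 0 -> f \in Lambda -> f \in homog w -> f = 0.
Proof.
move=> w0 /allP fL /allP fw; rewrite (qalgE f) big1_seq // => e /andP[_ ef].
suff : 0 <= weight e by have /eqP-> := fw e ef; rewrite leNgt w0.
have /Lambda_expoP[_ _ en] := fL e ef.
by apply: sumr_ge0 => i _; rewrite mulr_ge0 ?natr_ge0.
Qed.

Lemma homog_Delta w f : f \in homog w -> Delta f \in homog (w - 2).
Proof. by move=> fw; rewrite Delta_2; apply/supportedZ/(homog_Delta_ 2). Qed.

Lemma half_neq2 n r : (n%:R - r%:R * 2 + r%:R - 3 / 2 : rat) != 0.
Proof.
apply/eqP => E; have : ((n * 2)%:R : rat) = (r * 2 + 3)%:R.
  by rewrite natrD !natrM; lra.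
by move/eqP; rewrite eqr_nat; lia.
Qed.

(* Writing [f = Q_2^r g], the middle term of [Delta_qp] shows that [Q_2] divides
   [g] again; the degree bounds how often this can happen. *)
Lemma harmonic_qp_eq0 n k r g : (n <= r + k)%N ->
  g \in Lambda -> g \in homog (n%:R - r.+1%:R * 2) ->
  pr (Delta (qp r.+1%:R * g)) = 0 -> g = 0.
Proof.
elim: k r g => [|k IH] r g le gL gn D0.
  (* Here n <= r, so the weight n - 2(r + 1) is negative. *)
  apply: Lambda_homog_neg gL gn; rewrite subr_lt0 -natrM ltr_nat; lia.
(* The middle coefficient of [Delta_qp] at exponent r + 1 and weight n - 2(r + 1); it equals (r +
   1)(n - r - 5/2), which is never 0. *)
set c := r.+1%:R * (n%:R - r.+1%:R * 2 + r.+1%:R - 3 / 2) : rat.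
have c0 : c != 0 by rewrite mulf_neq0 ?pnatr_eq0 ?half_neq2.
have gR := Lambda_calR gL; pose u := pr (Delta g).
have uL : u \in Lambda by apply/pr_Lambda/calR_Delta.
have un : u \in homog (n%:R - r.+1%:R * 2 - 2) by apply/pr_homog/homog_Delta.
have int2 m : (m%:R : rat) *+ 2 \is a Num.int by rewrite -mulrnA intr_nat ?natr_nat.
have rE : r.+1%:R - 1 = r%:R :> rat by rewrite -natr1 addrK.
have E : qp r.+1%:R * u + c *: (qp r%:R * g) = 0.
  have pl (x y z : qalg) : pr (x + c *: y - z) = pr x + c *: pr y - pr z.
    by rewrite linearB linearD linearZ.
  move: D0; rewrite (Delta_qp _ gn) -/(correction _ _) -/c rE pl.
  rewrite (pr_q1 (tR_correction (int2 _) (calR_tR gR))) subr0.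
  rewrite (prM (tR_qp (int2 _)) (calR_tR (calR_Delta gR))) pr_qp -/u.
  by rewrite (prM (tR_qp (int2 _)) (calR_tR gR)) pr_qp pr_id.
pose g' : qalg := - c^-1 *: u.
have Eg : g = qvar 2 * g'.
  have lem (A : comAlgType rat) (a b p v h : A) : b * a = 1 ->
      a * p * v + c *: (a * h) = 0 -> h = p * (- c^-1 *: v).
    move=> ba1 /(congr1 (fun z => c^-1 *: (b * z))).
    rewrite mulr0 scaler0 mulrDr -scalerAr !mulrA ba1 mul1r mul1r scalerDr scalerA.
    by rewrite mulVf // scale1r => /eqP; rewrite addrC addr_eq0 scaleNr mulrN -scalerAr => /eqP.
  apply: (lem qalg (qp r%:R) (qp (- r%:R))); first by rewrite -qpD addNr qp0.
  by move: E; rewrite (qpS r.+1%:R) rE.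
have g'L : g' \in Lambda by apply: supportedZ.
have g'n : g' \in homog (n%:R - r.+2%:R * 2).
  have -> : n%:R - r.+2%:R * 2 = n%:R - r.+1%:R * 2 - 2 :> rat by rewrite -(natr1 r.+1); lra.
  exact: supportedZ.
suff g'0 : g' = 0 by rewrite Eg g'0; apply: mulr0.
apply: (IH r.+1) => //; first by rewrite addSnnS.
have -> : qp r.+2%:R * g' = qp r.+1%:R * g.
  by rewrite Eg (qpS r.+2%:R) -(natr1 r.+1) addrK; apply: esym; apply: mulrA.
exact: D0.
Qed.

Lemma harmonic_eq0 n f : harmonic n f -> (forall e, e@_2 = 0 -> f@_e = 0) -> f = 0.
Proof.
move=> /harmonicP[fL fn Df] f2.
(* Every monomial of f contains Q_2, so one factor can be split off; [harmonic_qp_eq0] then applies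
   with r = 0 and k = n. *)
have gL : qp (- 1) * f \in Lambda.
  apply: (@supportedM (pred1 (- 1 *: delta 2)) [pred e | (e \in Lambda_expo) && (e@_2 != 0)]).
  - move=> _ e /eqP-> /andP[/Lambda_expoP[e0 e1 en] e2]; apply/Lambda_expoP.
    rewrite !mcoeffD !mcoeffZ !mcoeff_delta !mulr0 !add0r; split=> // i.
    rewrite mcoeffD mcoeffZ mcoeff_delta addrC; case: (eqVneq 2%N i) => [<-|_].
      by rewrite mulr1; apply: natr_pred.
    by rewrite mulr0 addr0.
  - by rewrite supported_mono /= eqxx.
  apply/allP => e ef; have /allP/(_ e ef) /= eL := fL; apply/andP; split=> //.
  by apply/eqP => /f2/eqP; rewrite mcoeff_eq0 ef.
have gn : qp (- 1) * f \in homog (n%:R - 1%:R * 2).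
  have <- : - 1 * 2 + n%:R = n%:R - 1%:R * 2 :> rat by lra.
  by apply: homogM fn; apply: homog_qp.
have E : qp 1%:R * (qp (- 1) * f) = f by apply: (qpK 1).
have g0 := @harmonic_qp_eq0 n n 0 _ (leqnn _) gL gn
  (etrans (congr1 (fun x => pr (Delta x)) E) Df).
exact: etrans (esym E) (etrans (congr1 (fun x => qp 1%:R * x) g0) (mulr0 _)).
Qed.

(** * Linear combinations, partitions and the expansion *)

Lemma harmonic_linear n c f g : harmonic n f -> harmonic n g -> harmonic n (c *: f + g).
Proof.
move=> /harmonicP[fL fn Df] /harmonicP[gL gn Dg]; apply/harmonicP; split.
- exact: supportedP.
- exact: supportedP.
by rewrite [Delta _]linearP linearP /= Df Dg scaler0 addr0.
Qed.

Lemma harmonic0 n : harmonic n 0.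
Proof.
apply/harmonicP; split; try exact: supported0.
by rewrite [Delta _]linear0 linear0.
Qed.

Lemma harmonic_sum n (I : eqType) (s : seq I) (c : I -> rat) (F : I -> qalg) :
  {in s, forall i, harmonic n (F i)} -> harmonic n (\sum_(i <- s) c i *: F i).
Proof.
move=> sF; rewrite big_seq; apply: (big_rec (harmonic n)); first exact: harmonic0.
by move=> i x /sF Fi; apply: harmonic_linear.
Qed.

Definition part_of_expo (e : expo) : seq nat :=
  sort geq (flatten [seq nseq (Num.truncn e@_i) i | i <- msupp e]).

Lemma expo_of_perm la mu : perm_eq la mu -> expo_of la = expo_of mu.
Proof. exact: perm_big. Qed.

Lemma expo_of_part e : (forall i, e@_i \is a Num.nat) -> expo_of (part_of_expo e) = e.
Proof.
move=> en; rewrite (expo_of_perm (permEl (perm_sort _ _))).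
apply/malgP => j; rewrite mcoeff_expo_of count_flatten -map_comp sumnE big_map.
under eq_bigr => i _ do rewrite /= count_nseq /=.
have [je|je] := boolP (j \in msupp e).
  rewrite (bigD1_seq j) ?fset_uniq //= eqxx mul1n big1 ?addn0; last first.
    by move=> i /negPf ij; rewrite ij.
  by apply/truncnK/en.
rewrite big1_seq ?(mcoeff_outdom je) // => i /andP[_ ie].
by case: eqP ie je => // -> ->.
Qed.

Lemma sumn_weight la : weight (expo_of la) = (sumn la)%:R.
Proof.
rewrite /expo_of linear_sum /= sumnE natr_sum; apply: eq_bigr => i _.
exact: weight_delta.
Qed.

Lemma mem_expo_of la i : (i \in la) = ((expo_of la)@_i != 0).
Proof. by rewrite mcoeff_expo_of pnatr_eq0 -lt0n -has_count has_pred1. Qed.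

Lemma part_of_expoP n e : e \in Lambda_expo -> e@_2 = 0 -> weight e = n%:R ->
  is_partition_of n (part_of_expo e) /\ all (leq 3) (part_of_expo e).
Proof.
move=> /Lambda_expoP[e0 e1 en] e2 ew; have E := expo_of_part en.
have ge3 : all (leq 3) (part_of_expo e).
  apply/allP => i; rewrite mem_expo_of E; case: i => [|[|[|i]]] //.
  - by rewrite e0 eqxx.
  - by rewrite e1 eqxx.
  by rewrite e2 eqxx.
split=> //; apply/and3P; split.
- by apply: sort_sorted => x y; apply: leq_total.
- by apply: sub_all ge3 => i; apply: leq_trans.
by rewrite -(eqr_nat rat) -sumn_weight E ew.
Qed.

Lemma expo_of_inj la mu :
  sorted geq la -> sorted geq mu -> expo_of la = expo_of mu -> la = mu.
Proof.
move=> sla smu E; apply: (sorted_eq _ _ sla smu).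
- by move=> x y z /= yx zy; apply: leq_trans zy yx.
- by move=> x y /andP[yx xy]; apply: anti_leq; apply/andP; split.
apply/allP => i _; rewrite /= -(eqr_nat rat).
by rewrite -(mcoeff_expo_of la) -(mcoeff_expo_of mu) E.
Qed.

(** In [in_span] the coefficient is a function of the vector, whereas [H] may repeat values; the
    coefficients are therefore summed over each fibre of [H]. *)
Lemma in_span_sum (V : lmodType rat) (X : V -> Prop) (I : eqType) (s : seq I)
    (c : I -> rat) (H : I -> V) :
  {in s, forall i, X (H i)} -> in_span X (\sum_(i <- s) c i *: H i).
Proof.
move=> sX; exists (undup (map H s)), (fun v => \sum_(i <- s | H i == v) c i); split.
  by move=> v; rewrite mem_undup => /mapP[i /sX Xi ->].
rewrite [RHS](eq_bigr (fun v => \sum_(i <- s | H i == v) c i *: v)); last first.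
  by move=> v _; rewrite scaler_suml.
rewrite [RHS](exchange_big_dep xpredT) //= !big_seq; apply: eq_bigr => i si.
rewrite (eq_bigl (fun v => v == H i)) => [|v]; last by rewrite eq_sym.
rewrite -big_filter (_ : filter _ _ = [:: H i]) ?big_seq1 //.
rewrite filter_pred1_uniq ?undup_uniq // mem_undup; exact: map_f.
Qed.

Theorem theorem1p4 (n : nat) :
  is_basis
    (fun f : qalg => exists la : seq nat,
      [/\ is_partition_of n la, all (leq 3) la
        & f = pr (Kelvin (Delta_part la (Kelvin 1)))])
    (harmonic n).
Proof.
have harm la : is_partition_of n la -> harmonic n (basis_elt la).
  by move=> /and3P[_ _ /eqP<-]; apply: basis_elt_harmonic.
split=> [s c s_uniq sX s0 v vs|f]; last split.
- have [la [la_n la3 Ev]] := sX v vs; rewrite -/(basis_elt la) in Ev.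
  have e2 : (expo_of la)@_2 = 0.
    by apply/eqP; rewrite -[_ == _]negbK -mem_expo_of; apply/negP => /(allP la3).
  have [d d0 dE] := basis_elt_coef la3.
  (* The coefficient of the monomial Q_la, which is free of Q_2, isolates the term of [la]: any
     other [mu] has a different monomial. *)
  have /(congr1 (mcoeff (expo_of la))) := s0.
  rewrite mcoeff0 raddf_sum /= (bigD1_seq v) //= big1_seq ?addr0.
    by rewrite mcoeffZ Ev dE // eqxx mulr1 => /eqP; rewrite mulf_eq0 (negPf d0) orbF => /eqP.
  move=> u /andP[uv us]; have [mu [mu_n mu3 Eu]] := sX u us.
  rewrite -/(basis_elt mu) in Eu; have [d' _ d'E] := basis_elt_coef mu3.
  rewrite mcoeffZ Eu d'E //; case: eqP => [E|_]; last by rewrite !mulr0.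
  case/and3P: la_n => la_s _ _; case/and3P: mu_n => mu_s _ _.
  rewrite (expo_of_inj mu_s la_s E) in Eu.
  by case/eqP: uv; apply: etrans Eu (esym Ev).
- move=> hf; have [fL fn _] := hf.
  pose S := [seq e <- msupp f | e@_2 == 0].
  pose H e := basis_elt (part_of_expo e).
  have SP e : e \in S -> [/\ is_partition_of n (part_of_expo e),
      all (leq 3) (part_of_expo e) & expo_of (part_of_expo e) = e].
    rewrite mem_filter => /andP[/eqP e2 ef].
    have eL := allP fL e ef; have /eqP ew := allP fn e ef.
    have [p1 p2] := part_of_expoP eL e2 ew; split=> //.
    by apply: expo_of_part; case/Lambda_expoP: eL.
  have Hcoef e : e \in S -> (H e)@_e != 0 /\
      forall e', e'@_2 = 0 -> (H e)@_e' = (H e)@_e * (e == e')%:R.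
    move=> eS; have [_ p3 Ee] := SP e eS; have [d d0 dE] := basis_elt_coef p3.
    have e2 : e@_2 = 0 by move: eS; rewrite mem_filter => /andP[/eqP].
    by rewrite /H dE // Ee eqxx mulr1; split=> // e' e'2; rewrite dE // Ee.
  (* The coefficients are chosen so that f and g agree on monomials free of Q_2; f - g is harmonic,
     so [harmonic_eq0] forces f = g. *)
  pose g := \sum_(e <- S) (f@_e / (H e)@_e) *: H e.
  suff -> : f = g.
    apply: in_span_sum => e /SP[p1 p2 _]; by exists (part_of_expo e).
  apply/eqP; rewrite -subr_eq0; apply/eqP; apply: (@harmonic_eq0 n).
    rewrite addrC -scaleN1r; apply: harmonic_linear hf.
    by apply: harmonic_sum => e /SP[p1 _ _]; apply: harm.
  move=> e e2; rewrite mcoeffB raddf_sum /=.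
  have [eS|eS] := boolP (e \in S).
    rewrite (bigD1_seq e) ?filter_uniq ?fset_uniq //= big1_seq ?addr0.
      by rewrite mcoeffZ divfK ?subrr //; case: (Hcoef e eS).
    move=> e' /andP[/negPf e'e e'S]; rewrite mcoeffZ.
    by have [_ /(_ e e2) ->] := Hcoef e' e'S; rewrite e'e !mulr0.
  have fe0 : f@_e = 0.
    apply: mcoeff_outdom; apply: contra eS => ef; by rewrite mem_filter e2 eqxx.
  rewrite fe0 big1_seq ?subr0 // => e' /andP[_ e'S]; rewrite mcoeffZ.
  have [_ /(_ e e2) ->] := Hcoef e' e'S.
  by case: eqP eS => [<-|_ _]; rewrite ?e'S // !mulr0.
move=> [s [c [sX ->]]]; apply: harmonic_sum => v /sX[la [la_n _ ->]].
exact: harm.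
Qed.
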